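(* Let $R$ be an associative ring with identity such that $\mathcal{P}(R)\subseteq\mathcal{SFI}^{\vee}$ and $\mathrm{pd}(\mathcal{I}(R))<\infty$. Then $\mathrm{gl.GPD}(R)<\infty$; in consequence, $\mathcal{GP}$ is a special precovering class in $\mathrm{Mod}(R)$.
   Context: All modules are left $R$-modules; $\mathcal{P}(R)$ and $\mathcal{I}(R)$ are the classes of projective and injective left $R$-modules, and $\mathrm{pd}(\mathcal{I}(R)):=\sup\{\mathrm{pd}(I):I\in\mathcal{I}(R)\}$. $\mathcal{SFI}$ is the class of strongly FP-injective modules, i.e. modules $E$ with $\mathrm{Ext}^k_R(F,E)=0$ for all $k\ge1$ and all finitely presented modules $F$. $\mathcal{SFI}^{\vee}$ is the class of modules $M$ for which there exist $m\ge0$ and an exact sequence $0\to M\to E^0\to\cdots\to E^m\to0$ with all $E^i\in\mathcal{SFI}$. $\mathcal{GP}$ is the class of Gorenstein projective modules: cycles of acyclic complexes of projective modules that remain exact after applying $\mathrm{Hom}_R(-,P)$ for all $P\in\mathcal{P}(R)$. $\mathrm{Gpd}(M)$ is the least $m\ge 0$ such that there is an exact sequence $0\to G_m\to\cdots\to G_0\to M\to0$ with all $G_i\in\mathcal{GP}$ ($\infty$ if none), and $\mathrm{gl.GPD}(R):=\sup\{\mathrm{Gpd}(M):M\in\mathrm{Mod}(R)\}$. A class $\mathcal{X}$ is special precovering if every module $M$ has a special $\mathcal{X}$-precover, i.e. an epimorphism $\varphi:X\to M$ with $X\in\mathcal{X}$ and $\mathrm{Ext}^1_R(X',\mathrm{Ker}\,\varphi)=0$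 for all $X'\in\mathcal{X}$. *)

(* Defs.v *)
From HB Require Import structures.
From mathcomp Require Import all_boot all_order all_algebra.
From mathcomp Require Import boolp.

Set Implicit Arguments.
Unset Strict Implicit.
Unset Printing Implicit Defensive.

Import GRing.Theory.
Local Open Scope ring_scope.

(* Extended natural numbers are [option nat], with [None] standing for
   infinity. *)
Definition enat_le (x y : option nat) : Prop :=
  match x, y with
  | _, None => True
  | Some m, Some n => (m <= n)%N
  | None, Some _ => False
  end.

Definition enat_lt (x y : option nat) : Prop := enat_le x y /\ x <> y.

(* The least element of P, and infinity when P is empty. *)
Definition enat_least (P : nat -> Prop) : option nat :=
  match pselect (exists n, `[< P n >]) with
  | left ex => Some (ex_minn ex)
  | right _ => None
  end.

(* The least upper bound of {f t : t in D}: the least finite upper bound, and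
   infinity when there is none. *)
Definition enat_sup (T : Type) (D : T -> Prop) (f : T -> option nat) :
  option nat :=
  enat_least (fun n => forall t, D t -> enat_le (f t) (Some n)).

(* [pzRingType] is the type of associative unital rings, the zero ring
   included; an [lmodType R] is a left R-module. *)

Definition module_surjective (R : pzRingType) (A B : lmodType R)
    (f : {linear A -> B}) : Prop :=
  forall y : B, exists x : A, f x = y.

Definition module_exact (R : pzRingType) (A B C : lmodType R)
    (f : {linear A -> B}) (g : {linear B -> C}) : Prop :=
  forall y : B, g y = 0 <-> exists x : A, f x = y.

(* Exactness of Hom(C, E) -> Hom(B, E) -> Hom(A, E) at Hom(B, E). *)
Definition hom_exact (R : pzRingType) (A B C : lmodType R)
    (f : {linear A -> B}) (g : {linear B -> C}) (E : lmodType R) : Prop :=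
  forall h : {linear B -> E},
    (forall x : A, h (f x) = 0) <->
    (exists k : {linear C -> E}, forall y : B, k (g y) = h y).

Definition is_kernel (R : pzRingType) (K A B : lmodType R)
    (i : {linear K -> A}) (f : {linear A -> B}) : Prop :=
  injective i /\ module_exact i f.

Definition zero_module (R : pzRingType) (M : lmodType R) : Prop :=
  forall x : M, x = 0.

Definition projective (R : pzRingType) (P : lmodType R) : Prop :=
  forall (A B : lmodType R) (g : {linear A -> B}) (f : {linear P -> B}),
    module_surjective g ->
    exists h : {linear P -> A}, forall x : P, g (h x) = f x.

Definition injective_module (R : pzRingType) (E : lmodType R) : Prop :=
  forall (A B : lmodType R) (i : {linear A -> B}) (f : {linear A -> E}),
    injective i ->
    exists h : {linear B -> E}, forall x : A, h (i x) = f x.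

(* ... -> X 1 -> X 0 -> M -> 0 is exact. *)
Definition left_resolution (R : pzRingType) (M : lmodType R)
    (X : nat -> lmodType R) (d : forall n, {linear X n.+1 -> X n})
    (e : {linear X 0%N -> M}) : Prop :=
  [/\ module_surjective e,
      module_exact (d 0%N) e &
      forall n, module_exact (d n.+1) (d n)].

(* 0 -> M -> X 0 -> X 1 -> ... is exact. *)
Definition right_resolution (R : pzRingType) (M : lmodType R)
    (X : nat -> lmodType R) (d : forall n, {linear X n -> X n.+1})
    (e : {linear M -> X 0%N}) : Prop :=
  [/\ injective e,
      module_exact e (d 0%N) &
      forall n, module_exact (d n) (d n.+1)].

(* An exact sequence 0 -> X m -> ... -> X 0 -> M -> 0 with terms in the class
   C, written as an infinite one that vanishes beyond m. *)
Definition has_left_resolution (R : pzRingType) (C : lmodType R -> Prop)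
    (M : lmodType R) (m : nat) : Prop :=
  exists (X : nat -> lmodType R) (d : forall n, {linear X n.+1 -> X n})
         (e : {linear X 0%N -> M}),
    [/\ left_resolution d e,
        forall n, (n <= m)%N -> C (X n) &
        forall n, (m < n)%N -> zero_module (X n)].

(* Dually, 0 -> M -> X 0 -> ... -> X m -> 0. *)
Definition has_right_resolution (R : pzRingType) (C : lmodType R -> Prop)
    (M : lmodType R) (m : nat) : Prop :=
  exists (X : nat -> lmodType R) (d : forall n, {linear X n -> X n.+1})
         (e : {linear M -> X 0%N}),
    [/\ right_resolution d e,
        forall n, (n <= m)%N -> C (X n) &
        forall n, (m < n)%N -> zero_module (X n)].

(* Ext^{n+1}(M, N) = 0: the cochain complex Hom(X, N) has no cohomology in
   degree n + 1, for X a projective resolution of M. Every M has a projective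
   resolution and the cohomology does not depend on it, so quantifying over
   all of them is neither vacuous nor a restriction. *)
Definition Ext_succ_vanishes (R : pzRingType) (n : nat) (M N : lmodType R) :
  Prop :=
  forall (X : nat -> lmodType R) (d : forall i, {linear X i.+1 -> X i})
         (e : {linear X 0%N -> M}),
    (forall i, projective (X i)) -> left_resolution d e ->
    hom_exact (d n.+1) (d n) N.

Definition finitely_presented (R : pzRingType) (F : lmodType R) : Prop :=
  exists (m n : nat) (f : {linear 'rV[R]_m -> 'rV[R]_n})
         (g : {linear 'rV[R]_n -> F}),
    module_surjective g /\ module_exact f g.

Definition strongly_FP_injective (R : pzRingType) (E : lmodType R) : Prop :=
  forall (k : nat) (F : lmodType R),
    finitely_presented F -> Ext_succ_vanishes k F E.

Definition SFI_vee (R : pzRingType) (M : lmodType R) : Prop :=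
  exists m : nat, has_right_resolution (@strongly_FP_injective R) M m.

Definition Gorenstein_projective (R : pzRingType) (M : lmodType R) : Prop :=
  exists (X : int -> lmodType R) (d : forall i : int, {linear X (i + 1) -> X i}),
    [/\ forall i, projective (X i),
        forall i, module_exact (d (i + 1)) (d i),
        forall (P : lmodType R) i,
          projective P -> hom_exact (d (i + 1)) (d i) P &
        exists (i : int) (j : {linear M -> X (i + 1)}), is_kernel j (d i)].

Definition resolution_dim (R : pzRingType) (C : lmodType R -> Prop)
    (M : lmodType R) : option nat :=
  enat_least (has_left_resolution C M).

Definition pd (R : pzRingType) (M : lmodType R) : option nat :=
  resolution_dim (@projective R) M.

Definition pd_injectives (R : pzRingType) : option nat :=
  enat_sup (@injective_module R) (@pd R).

Definition Gpd (R : pzRingType) (M : lmodType R) : option nat :=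
  resolution_dim (@Gorenstein_projective R) M.

Definition gl_GPD (R : pzRingType) : option nat :=
  enat_sup (fun _ : lmodType R => True) (@Gpd R).

Definition special_precovering (R : pzRingType) (C : lmodType R -> Prop) :
  Prop :=
  forall M : lmodType R,
  exists (X : lmodType R) (phi : {linear X -> M}),
    [/\ C X,
        module_surjective phi &
        exists (K : lmodType R) (i : {linear K -> X}),
          is_kernel i phi /\
          forall X' : lmodType R, C X' -> Ext_succ_vanishes 0 X' K].

(* Main.v *)
Require Import Defs.
From HB Require Import structures.
From mathcomp Require Import all_boot all_order all_algebra.
From mathcomp Require Import boolp classical_sets functions.

(** Call a module right projective when it has an infinite coresolution
    0 -> Z -> X^0 -> X^1 -> ... by projective modules, and let perp be the
    class of all N with Ext^1(Z, N) = 0 for every right projective Z.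

    The heart of the proof is that every strongly FP-injective module E lies in
    perp (Ext1_right_projective_SFI). Glue a free presentation of Z to its
    projective coresolution: this gives a complex W^0 -> W^1 -> ... of
    projectives. Compare it with the injective coresolution
    0 -> E -> I^0 -> I^1 -> ..., a complex called Y. A map from the first
    syzygy of Z to E extends to a chain map W -> Y, because W is exact and the
    I^k are injective. The cosyzygies of E are again strongly FP-injective, so
    every finite system of linear equations that is solvable in I^k with
    right-hand sides in the cosyzygy is solvable in the cosyzygy: Y is purely
    exact. By null_homotopic, any chain map from a complex of projectives that
    starts in degree 0 to a purely exact complex is null-homotopic, and the
    lowest component of the homotopy is the extension to be found.

    For null_homotopic, the projectives are first replaced by free modules.
    Zorn's lemma then applies to the homotopies defined on parts of the bases
    that are closed under the differential. Adding one basis element forces the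
    addition of everything that its iterated differentials involve, but this is
    a finite set in each degree; so only finite systems have to be solved in Y,
    and purity does that (extension_step).

    The class perp is closed under kernels of epimorphisms, so it contains
    SFI_vee, hence all projectives under the first hypothesis. Therefore every
    acyclic complex of projectives is totally acyclic, and the Gorenstein
    projective modules are exactly the right projective ones
    (right_projective_Gorenstein, Gorenstein_right_projective).

    If all injectives have projective dimension at most n, the horseshoe lemma,
    applied n times to an injective coresolution of M, turns it into a
    projective coresolution of the n-th syzygy of M
    (syzygies_right_projective). That syzygy is thus Gorenstein projective,
    and Gpd M <= n. The special precover of M is found by induction on n, from
    one for the first syzygy of M by means of a pushout
    (special_approximation); its kernel is in perp because perp is closed under
    cokernels of monomorphisms. *)

Set Implicit Arguments.
Unset Strict Implicit.
Unset Printing Implicit Defensive.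

Import GRing.Theory Num.Theory.
Local Open Scope ring_scope.

(** * Linear maps, submodules and quotients *)

Section LinearMaps.
Variable R : pzRingType.

Definition linear_map (A B : lmodType R) (f : A -> B) (Hf : linear f) :
    {linear A -> B} :=
  HB.pack f (GRing.isLinear.Build R A B *:%R f Hf).

Fact zero_linear (A B : lmodType R) : linear (fun _ : A => 0 : B).
Proof. by move=> a x y; rewrite scaler0 addr0. Qed.

Definition zero_map (A B : lmodType R) : {linear A -> B} :=
  linear_map (@zero_linear A B).

Definition zero_mod : lmodType R := 'rV[R]_0.
Lemma zero_modE (x y : zero_mod) : x = y.
Proof. by rewrite (thinmx0 x) (thinmx0 y). Qed.

Fact fst_linear (A B : lmodType R) : linear (fun x : A * B => x.1).
Proof. by []. Qed.
Definition fst_map (A B : lmodType R) : {linear (A * B)%type -> A} :=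
  linear_map (@fst_linear A B).
Fact snd_linear (A B : lmodType R) : linear (fun x : A * B => x.2).
Proof. by []. Qed.
Definition snd_map (A B : lmodType R) : {linear (A * B)%type -> B} :=
  linear_map (@snd_linear A B).

Fact inl_linear (A B : lmodType R) : linear (fun x : A => (x, 0) : A * B).
Proof. by move=> a x y; rewrite -[RHS]/(_, a *: 0 + 0) scaler0 addr0. Qed.
Definition inl_map (A B : lmodType R) : {linear A -> (A * B)%type} :=
  linear_map (@inl_linear A B).
Fact inr_linear (A B : lmodType R) : linear (fun x : B => (0, x) : A * B).
Proof. by move=> a x y; rewrite -[RHS]/(a *: 0 + 0, _) scaler0 addr0. Qed.
Definition inr_map (A B : lmodType R) : {linear B -> (A * B)%type} :=
  linear_map (@inr_linear A B).

Fact comp_linear (A B C : lmodType R) (g : {linear B -> C}) (f : {linear A -> B}) :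
  linear (fun x => g (f x)).
Proof. by move=> a x y; rewrite !linearP. Qed.
Definition comp_map (A B C : lmodType R) (g : {linear B -> C}) (f : {linear A -> B}) :
  {linear A -> C} := linear_map (comp_linear g f).

Lemma comp_mapE (A B C : lmodType R) (g : {linear B -> C})
  (f : {linear A -> B}) x : comp_map g f x = g (f x).
Proof. by []. Qed.

Fact sub_fun_linear (A B : lmodType R) (f g : {linear A -> B}) :
  linear (fun x => f x - g x).
Proof. by move=> a x y; rewrite !(linearP f, linearP g) scalerBr opprD addrACA. Qed.
Definition sub_map (A B : lmodType R) (f g : {linear A -> B}) : {linear A -> B} :=
  linear_map (sub_fun_linear f g).

Fact add_fun_linear (A B : lmodType R) (f g : {linear A -> B}) :
  linear (fun x => f x + g x).
Proof. by move=> a x y; rewrite !(linearP f, linearP g) scalerDr addrACA. Qed.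
Definition add_map (A B : lmodType R) (f g : {linear A -> B}) : {linear A -> B} :=
  linear_map (add_fun_linear f g).

Fact id_linear (A : lmodType R) : linear (fun x : A => x). Proof. by []. Qed.
Definition id_map (A : lmodType R) : {linear A -> A} := linear_map (@id_linear A).

(** Linearity of the chosen factor is automatic: two values over the same
    point of B differ by an element of the kernel of g. *)
Lemma factor_surj (A B C : lmodType R) (g : {linear A -> B}) (f : {linear A -> C}) :
  module_surjective g -> (forall x, g x = 0 -> f x = 0) ->
  exists h : {linear B -> C}, forall x, h (g x) = f x.
Proof.
move=> gsurj kerg; have [s sK] := choice gsurj.
have hK x : f (s (g x)) = f x.
  by apply/eqP; rewrite -subr_eq0 -linearB kerg // linearB sK subrr.
have hlin : linear (fun y => f (s y)).
  by move=> a x y; rewrite -{1}(sK x) -{1}(sK y) -linearP hK linearP.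
by exists (linear_map hlin).
Qed.

Lemma lift_inj (A B C : lmodType R) (i : {linear A -> B}) (f : {linear C -> B}) :
  injective i -> (forall x, exists a, i a = f x) ->
  exists h : {linear C -> A}, forall x, i (h x) = f x.
Proof.
move=> iinj /choice[h hE].
have hlin : linear h by move=> a x y; apply: iinj; rewrite linearP !hE linearP.
by exists (linear_map hlin).
Qed.

End LinearMaps.

Section Submodules.
Variables (R : pzRingType) (M : lmodType R).

(** Membership is a Prop and not a boolean, so that kernels, images and sets
    of relations are submodules without any decidability. *)
Record submodule := Submodule {
  mem_sub :> M -> Prop;
  sub0P : mem_sub 0;
  sub_linear : forall a x y, mem_sub x -> mem_sub y -> mem_sub (a *: x + y) }.

Variable K : submodule.

Lemma subm_add x y : K x -> K y -> K (x + y).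
Proof. by move=> Kx Ky; rewrite -[x]scale1r; apply: sub_linear. Qed.
Lemma subm_scale a x : K x -> K (a *: x).
Proof. by move=> Kx; rewrite -[_ *: _]addr0; apply/sub_linear/sub0P. Qed.
Lemma subm_opp x : K x -> K (- x).
Proof. by move=> Kx; rewrite -scaleN1r; apply: subm_scale. Qed.

Record sub_type := SubElt { sub_val : M; sub_valP : K sub_val }.

Lemma sub_val_inj : injective sub_val.
Proof. by move=> [x Kx] [y Ky] /= e; subst y; rewrite (Prop_irrelevance Kx Ky). Qed.

HB.instance Definition _ := gen_eqMixin sub_type.
HB.instance Definition _ := gen_choiceMixin sub_type.

Definition sub_zero := SubElt (sub0P K).
Definition sub_add x y := SubElt (subm_add (sub_valP x) (sub_valP y)).
Definition sub_opp x := SubElt (subm_opp (sub_valP x)).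
Definition sub_scale a x := SubElt (subm_scale a (sub_valP x)).

Fact sub_addA : associative sub_add.
Proof. by move=> x y z; apply: sub_val_inj; rewrite /= addrA. Qed.
Fact sub_addC : commutative sub_add.
Proof. by move=> x y; apply: sub_val_inj; rewrite /= addrC. Qed.
Fact sub_add0 : left_id sub_zero sub_add.
Proof. by move=> x; apply: sub_val_inj; rewrite /= add0r. Qed.
Fact sub_addN : left_inverse sub_zero sub_opp sub_add.
Proof. by move=> x; apply: sub_val_inj; rewrite /= addNr. Qed.
HB.instance Definition _ :=
  GRing.isZmodule.Build sub_type sub_addA sub_addC sub_add0 sub_addN.

Fact sub_scaleA a b v : sub_scale a (sub_scale b v) = sub_scale (a * b) v.
Proof. by apply: sub_val_inj; rewrite /= scalerA. Qed.
Fact sub_scale1 : left_id 1 sub_scale.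
Proof. by move=> x; apply: sub_val_inj; rewrite /= scale1r. Qed.
Fact sub_scaleDr : right_distributive sub_scale +%R.
Proof. by move=> a x y; apply: sub_val_inj; rewrite /= scalerDr. Qed.
Fact sub_scaleDl v : {morph sub_scale^~ v : a b / a + b}.
Proof. by move=> a b; apply: sub_val_inj; rewrite /= scalerDl. Qed.
HB.instance Definition _ := GRing.Zmodule_isLmodule.Build R sub_type
  sub_scaleA sub_scale1 sub_scaleDr sub_scaleDl.

Fact sub_val_linear : linear sub_val. Proof. by []. Qed.
Definition sub_incl : {linear sub_type -> M} := linear_map sub_val_linear.

(** A coset is represented by its own membership predicate, which keeps the
    quotient in the universe of the module. *)
Record quo_type := QuoElt {
  quo_class : M -> Prop;
  quo_classP : exists x, quo_class = fun y => K (y - x) }.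

HB.instance Definition _ := gen_eqMixin quo_type.
HB.instance Definition _ := gen_choiceMixin quo_type.

Definition quo (x : M) : quo_type :=
  QuoElt (ex_intro (fun z => (fun y => K (y - x)) = (fun y => K (y - z))) x erefl).

Lemma quo_eqP x y : quo x = quo y <-> K (x - y).
Proof.
split=> [[/(congr1 (fun F => F x))] | Kxy].
  by rewrite subrr => <-; apply: sub0P.
have e : (fun z => K (z - x)) = (fun z => K (z - y)).
  apply/funext => z; apply/propext; split=> Kz.
    by rewrite -[z](subrK x) -addrA; apply: subm_add.
  by rewrite -[z](subrK y) -addrA -[y - x]opprB; apply/subm_add/subm_opp.
rewrite /quo; move: (ex_intro _ _ _) (ex_intro _ _ _).
by rewrite e => p q; rewrite (Prop_irrelevance p q).
Qed.

Definition quo_repr (q : quo_type) : M := projT1 (cid (quo_classP q)).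

Lemma quo_reprK q : quo (quo_repr q) = q.
Proof.
rewrite /quo_repr; case: q => S P /=; case: cid => x /= e; subst S.
by rewrite /quo (Prop_irrelevance P (ex_intro _ x erefl)).
Qed.

Lemma quoW (P : quo_type -> Prop) : (forall x, P (quo x)) -> forall q, P q.
Proof. by move=> H q; rewrite -(quo_reprK q). Qed.

Lemma quo_reprE x : K (quo_repr (quo x) - x).
Proof. by apply/quo_eqP/quo_reprK. Qed.

Definition quo_zero := quo 0.
Definition quo_add p q := quo (quo_repr p + quo_repr q).
Definition quo_opp p := quo (- quo_repr p).
Definition quo_scale a p := quo (a *: quo_repr p).

Lemma quo_addE x y : quo_add (quo x) (quo y) = quo (x + y).
Proof.
by apply/quo_eqP; rewrite opprD addrACA; apply/subm_add/quo_reprE/quo_reprE.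
Qed.
Lemma quo_oppE x : quo_opp (quo x) = quo (- x).
Proof. by apply/quo_eqP; rewrite -opprD; apply/subm_opp/quo_reprE. Qed.
Lemma quo_scaleE a x : quo_scale a (quo x) = quo (a *: x).
Proof. by apply/quo_eqP; rewrite -scalerBr; apply/subm_scale/quo_reprE. Qed.

Fact quo_addA : associative quo_add.
Proof.
by elim/quoW=> x; elim/quoW=> y; elim/quoW=> z; rewrite !quo_addE addrA.
Qed.
Fact quo_addC : commutative quo_add.
Proof. by elim/quoW=> x; elim/quoW=> y; rewrite !quo_addE addrC. Qed.
Fact quo_add0 : left_id quo_zero quo_add.
Proof. by elim/quoW=> x; rewrite quo_addE add0r. Qed.
Fact quo_addN : left_inverse quo_zero quo_opp quo_add.
Proof. by elim/quoW=> x; rewrite quo_oppE quo_addE addNr. Qed.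
HB.instance Definition _ :=
  GRing.isZmodule.Build quo_type quo_addA quo_addC quo_add0 quo_addN.

Fact quo_scaleA a b v : quo_scale a (quo_scale b v) = quo_scale (a * b) v.
Proof. by elim/quoW: v => x; rewrite !quo_scaleE scalerA. Qed.
Fact quo_scale1 : left_id 1 quo_scale.
Proof. by elim/quoW=> x; rewrite quo_scaleE scale1r. Qed.
Fact quo_scaleDr : right_distributive quo_scale +%R.
Proof.
move=> a; elim/quoW=> x; elim/quoW=> y.
by rewrite [quo x + _]quo_addE !quo_scaleE [RHS]quo_addE scalerDr.
Qed.
Fact quo_scaleDl v : {morph quo_scale^~ v : a b / a + b}.
Proof.
by elim/quoW: v => x a b; rewrite !quo_scaleE [RHS]quo_addE scalerDl.
Qed.
HB.instance Definition _ := GRing.Zmodule_isLmodule.Build R quo_type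
  quo_scaleA quo_scale1 quo_scaleDr quo_scaleDl.

Fact quo_linear : linear quo.
Proof.
by move=> a x y; rewrite [a *: quo x]quo_scaleE [RHS]quo_addE.
Qed.
Definition quo_proj : {linear M -> quo_type} := linear_map quo_linear.

Lemma quo_proj_surj : module_surjective quo_proj.
Proof. by elim/quoW=> x; exists x. Qed.

Lemma quo_proj_eq0 x : quo_proj x = 0 <-> K x.
Proof. by split=> [/quo_eqP | Kx]; [|apply/quo_eqP]; rewrite subr0. Qed.

End Submodules.

Section KernelImage.
Variables (R : pzRingType) (A B : lmodType R) (f : {linear A -> B}).

Fact ker_linear a x y : f x = 0 -> f y = 0 -> f (a *: x + y) = 0.
Proof. by rewrite linearP => -> ->; rewrite scaler0 addr0. Qed.
Definition ker_sub := Submodule (linear0 f) ker_linear.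

Fact im_zero : exists x, f x = 0. Proof. by exists 0; rewrite linear0. Qed.
Fact im_linear a x y : (exists u, f u = x) -> (exists v, f v = y) ->
  exists w, f w = a *: x + y.
Proof. by move=> [u <-] [v <-]; exists (a *: u + v); rewrite linearP. Qed.
Definition im_sub := Submodule im_zero im_linear.

Lemma ker_sub_kernel : is_kernel (sub_incl ker_sub) f.
Proof.
split; first exact: sub_val_inj.
by move=> y; split=> [fy | [[x fx] <-] //]; exists (@SubElt _ _ ker_sub y fy).
Qed.

End KernelImage.

(** * Free modules *)

Section FreeModule.
Variables (R : pzRingType) (B : choiceType).

Definition finite_support (f : B -> R^o) : Prop :=
  exists s : seq B, forall b, f b != 0 -> b \in s.

Fact finite_support0 : finite_support 0.
Proof. by exists [::] => b; rewrite eqxx. Qed.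
Fact finite_support_linear a f g :
  finite_support f -> finite_support g -> finite_support (a *: f + g).
Proof.
move=> [s fs] [t gt]; exists (s ++ t) => b; apply: contraR.
rewrite mem_cat negb_or => /andP[bs bt].
have /eqP f0 : f b == 0 by apply: contraR bs; apply: fs.
have /eqP g0 : g b == 0 by apply: contraR bt; apply: gt.
by apply/eqP; rewrite -[LHS]/(a *: f b + g b) f0 g0 scaler0 addr0.
Qed.
Definition free : lmodType R :=
  sub_type (Submodule finite_support0 finite_support_linear).

Definition coef (x : free) (b : B) : R := sub_val x b.

Lemma coef_inj x y : (forall b, coef x b = coef y b) -> x = y.
Proof. by move=> e; apply/sub_val_inj/funext. Qed.

Lemma coef_linear b : linear (fun x => coef x b : R^o).
Proof. by []. Qed.

Fact gen_support b : finite_support (fun b' => (b' == b)%:R).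
Proof. by exists [:: b] => b'; rewrite inE; case: (b' == b) => //; rewrite eqxx. Qed.
Definition gen b : free :=
  @SubElt _ _ (Submodule finite_support0 finite_support_linear) _ (gen_support b).

Lemma coef_gen b b' : coef (gen b) b' = (b' == b)%:R. Proof. by []. Qed.

Definition supp (x : free) : seq B :=
  [seq b <- undup (projT1 (cid (sub_valP x))) | coef x b != 0].
Lemma supp_uniq x : uniq (supp x).
Proof. by rewrite filter_uniq ?undup_uniq. Qed.
Lemma mem_supp x b : (b \in supp x) = (coef x b != 0).
Proof.
rewrite mem_filter mem_undup; case: cid => s /= H.
by case: (boolP (coef x b != 0)) => // /H ->.
Qed.

Lemma coefP x s b : coef (\sum_(b' <- s) coef x b' *: gen b') b =
  \sum_(b' <- s) (coef x b' * (b == b')%:R).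
Proof.
pose c : {linear free -> R^o} := linear_map (coef_linear b).
by rewrite -[LHS]/(c _) linear_sum; apply: eq_bigr => b' _; rewrite linearZ.
Qed.

Lemma free_sum_gen x : x = \sum_(b <- supp x) coef x b *: gen b.
Proof.
apply: coef_inj => b; rewrite coefP.
have [bs|bs] := boolP (b \in supp x); last first.
  rewrite big1_seq => [|b' /andP[_ b's]].
    by move: bs; rewrite mem_supp negbK => /eqP.
  by case: eqP => [e|]; rewrite ?mulr0 //; move: bs; rewrite e b's.
rewrite (bigD1_seq b) ?supp_uniq //= eqxx mulr1 big1 ?addr0 // => b' ne.
by rewrite eq_sym (negbTE ne) mulr0.
Qed.

Variable Y : lmodType R.

Lemma linear_on_supp (f : {linear free -> Y}) x :
  f x = \sum_(b <- supp x) coef x b *: f (gen b).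
Proof.
rewrite {1}(free_sum_gen x) linear_sum; apply: eq_bigr => b _.
exact: linearZ.
Qed.

Lemma eq_on_gen (f g : {linear free -> Y}) x :
  (forall b, b \in supp x -> f (gen b) = g (gen b)) -> f x = g x.
Proof.
move=> e; rewrite !linear_on_supp; apply: eq_big_seq => b bx.
by rewrite e.
Qed.

Variable v : B -> Y.

Lemma sum_coef_any x s : uniq s -> {subset supp x <= s} ->
  \sum_(b <- s) coef x b *: v b = \sum_(b <- supp x) coef x b *: v b.
Proof.
move=> us sP; rewrite (bigID (fun b => b \in supp x)) /= [X in _ + X]big1 ?addr0.
  rewrite -big_filter; apply: perm_big.
  apply: uniq_perm; [exact: filter_uniq | exact: supp_uniq |].
  by move=> b; rewrite mem_filter; apply: andb_idr => /sP.
by move=> b; rewrite mem_supp negbK => /eqP ->; rewrite scale0r.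
Qed.

Fact extend_linear_proof : linear (fun x => \sum_(b <- supp x) coef x b *: v b).
Proof.
move=> a x y; pose s := undup (supp (a *: x + y) ++ supp x ++ supp y).
have us : uniq s by apply: undup_uniq.
rewrite -(@sum_coef_any (a *: x + y) s) // => [|b bx]; last first.
  by rewrite [_ \in s]mem_undup !mem_cat bx.
rewrite -(@sum_coef_any x s) // => [|b bx]; last first.
  by rewrite [_ \in s]mem_undup !mem_cat bx orbT.
rewrite -(@sum_coef_any y s) // => [|b bx]; last first.
  by rewrite [_ \in s]mem_undup !mem_cat bx !orbT.
rewrite scaler_sumr -big_split /=; apply: eq_bigr => b _.
by rewrite scalerA -scalerDl.
Qed.

Definition extend : {linear free -> Y} := linear_map extend_linear_proof.

Lemma extend_gen b : extend (gen b) = v b.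
Proof.
rewrite /= -(@sum_coef_any _ [:: b]) // => [|b'].
  by rewrite big_seq1 coef_gen eqxx scale1r.
by rewrite mem_supp coef_gen inE; case: (b' == b) => //; rewrite eqxx.
Qed.

End FreeModule.

Lemma free_projective (R : pzRingType) (B : choiceType) : projective (free R B).
Proof.
move=> A C g f gsurj; have [s sK] := choice gsurj.
exists (extend (fun b => s (f (gen R b)))) => x.
apply: (@eq_on_gen _ _ _ (comp_map g _) f) => b _.
by rewrite comp_mapE extend_gen sK.
Qed.

Arguments free_projective R B : clear implicits.

Section FreeCover.
Variables (R : pzRingType) (M : lmodType R).
Definition free_cover : {linear free R M -> M} := extend id.
Lemma free_cover_surj : module_surjective free_cover.
Proof. by move=> x; exists (gen R x); rewrite extend_gen. Qed.
Definition syzygy : lmodType R := sub_type (ker_sub free_cover).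
Definition syzygy_incl : {linear syzygy -> free R M} := sub_incl (ker_sub free_cover).
Lemma syzygy_kernel : is_kernel syzygy_incl free_cover.
Proof. exact: ker_sub_kernel. Qed.
End FreeCover.

(** * Extension of additive maps into divisible groups *)

(** The index is shifted to avoid multiplication by 0. *)
Definition divisible (D : zmodType) : Prop :=
  forall (n : nat) (d : D), exists d', d' *+ n.+1 = d.

Section DivisibleExtension.
Variables (A B D : zmodType) (i : {additive A -> B}) (f : {additive A -> D}).
Hypotheses (i_inj : injective i) (D_div : divisible D).

(** A homomorphism from a subgroup of B to D, encoded by its graph. The last
    clause is conditional because the union of the empty chain in Zorn's lemma
    has to satisfy the predicate. *)
Definition partial_extension (G : set (B * D)) : Prop :=
  [/\ forall p q, G p -> G q -> G (p - q),
      forall d, G (0, d) -> d = 0 &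
      forall p, G p -> forall a, G (i a, f a)].

Lemma partial_extension_max :
  exists2 G, partial_extension G /\ (forall a, G (i a, f a)) &
    forall G' : set (B * D), partial_extension G' -> (G `<=` G')%classic ->
      (G' `<=` G)%classic.
Proof.
have [F FP Ftot | G [Gext Gmax]] := @Zorn_bigcup _ partial_extension.
  split=> [p q [G1 F1 p1] [G2 F2 q2] | d [G1 F1 d1] | p [G1 F1 p1] a].
  - have [G12|G21] := Ftot _ _ F1 F2.
      by exists G2 => //; have [s2 _ _] := FP _ F2; apply: s2 => //; apply: G12.
    by exists G1 => //; have [s1 _ _] := FP _ F1; apply: s1 => //; apply: G21.
  - by have [_ z _] := FP _ F1; apply: z.
  - by exists G1 => //; have [_ _ b1] := FP _ F1; apply: b1 p1 _.
have GP G' : partial_extension G' -> (G `<=` G')%classic -> (G' `<=` G)%classic.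
  move=> extG' sub p G'p; apply: contrapT => nGp.
  by apply: (Gmax G') extG'; split=> // /(_ _ G'p).
exists G => //; split=> //.
have [[p Gp] | Ge] := pselect (exists p, G p).
  by case: Gext => _ _; apply; apply: Gp.
pose G0 : set (B * D) := fun p => exists a, p = (i a, f a).
have G0ext : partial_extension G0.
  split=> [_ _ [a ->] [a' ->] | d [a [ia ->]] | _ _ a]; last by exists a.
    by exists (a - a'); rewrite !raddfB.
  by have /i_inj <- : i 0 = i a; rewrite ?raddf0.
have sub : (G `<=` G0)%classic by move=> p Gp; case: Ge; exists p.
by move=> a; apply: (GP _ G0ext sub); exists a.
Qed.

Section OneStep.
Variables (G : set (B * D)) (b : B).
Hypothesis Gext : partial_extension G.
Hypothesis G00 : G (0, 0).

Let Gopp p : G p -> G (- p).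
Proof. by case: Gext => GB _ _ Gp; rewrite -sub0r; apply: GB. Qed.
Let Gadd p q : G p -> G q -> G (p + q).
Proof. by case: Gext => GB _ _ Gp Gq; rewrite -[q]opprK; apply/GB/Gopp. Qed.
Let Gmul p (n : int) : G p -> G (p *~ n).
Proof.
move=> Gp; have Gn (m : nat) : G (p *+ m).
  by elim: m => [|m IH]; rewrite ?mulr0n // mulrS; apply: Gadd.
by case: n => m; [exact: Gn | exact/Gopp/Gn].
Qed.
Let Gfun x y y' : G (x, y) -> G (x, y') -> y = y'.
Proof.
case: Gext => GB G0 _ Gy Gy'; apply/eqP; rewrite -subr_eq0; apply/eqP/G0.
by have : G (x - x, y - y') := GB _ _ Gy Gy'; rewrite subrr.
Qed.
Let pairMz x y (n : int) : ((x : B), (y : D)) *~ n = (x *~ n, y *~ n).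
Proof.
have pn (m : nat) : (x, y) *+ m = (x *+ m, y *+ m).
  by elim: m => [|m IH] //; rewrite !mulrS IH.
by case: n => m; rewrite ?NegzE ?mulrNz -!pmulrn pn.
Qed.

(** The multiples of b that fall in the domain of G form a subgroup kZ of Z,
    and divisibility of D lets one divide the value at k b by k. *)
Lemma value_on_new : exists d, forall (n : int) y, G (b *~ n, y) -> y = d *~ n.
Proof.
(* k.+1 is the least positive multiple of b in the domain, if there is one. *)
have [[k kP] | none] := pselect (exists k : nat, `[< exists e, G (b *+ k.+1, e) >]).
  case: (ex_minnP (ex_intro (fun k : nat => `[< exists e, G (b *+ k.+1, e) >]) k kP)).
  move=> {kP}k /asboolP[e Ge] kmin.
  have [d de] := D_div k e; exists d => n y Gy.
  have Gd : G (b *+ k.+1, d *+ k.+1) by rewrite de.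
  set q := (n %/ k.+1)%Z.
  have [r [rk nE]] : exists r, (r < k.+1)%N /\ n = q * k.+1 + r%:Z.
    have : (0 <= n %% k.+1)%Z by apply: modz_ge0.
    have : (n %% k.+1 < k.+1)%Z by apply: ltz_pmod.
    case: (n %% k.+1)%Z (divz_eq n k.+1) => // r nE rk _; exists r.
    by split=> //; rewrite -nE.
  have dk (x : D) : x *+ k.+1 *~ q = x *~ (q * k.+1) by rewrite pmulrn -mulrzA mulrC.
  have bk (x : B) : x *+ k.+1 *~ q = x *~ (q * k.+1) by rewrite pmulrn -mulrzA mulrC.
  have Gr : G (b *+ r, y - d *~ (q * k.+1)).
    have := Gadd Gy (Gopp (Gmul q Gd)); rewrite pairMz dk bk => Gyd.
    have : G (b *~ n - b *~ (q * k.+1), y - d *~ (q * k.+1)) := Gyd.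
    by rewrite {1}nE mulrzDr addrAC subrr add0r.
  case: r rk nE Gr => [|r] rk nE Gr.
    by move: (Gfun Gr G00) => /subr0_eq ->; rewrite nE addr0.
  have := kmin r; rewrite leqNgt -ltnS rk => H; suff: false by []; apply: H.
  by apply/asboolP; eexists; exact: Gr.
exists 0 => n y; rewrite mul0rz; case: n => [[|n]|n] Gy.
- by apply: (Gfun Gy).
- by case: none; exists n; apply/asboolP; exists y.
- case: none; exists n; apply/asboolP; exists (- y).
  by have : G (- (b *~ Negz n), - y) := Gopp Gy; rewrite NegzE mulrNz opprK.
Qed.

Lemma one_step_extension :
  exists2 G', partial_extension G' /\ (G `<=` G')%classic & exists d, G' (b, d).
Proof.
have [d dP] := value_on_new.
pose G' : set (B * D) := fun p =>
  exists (q : B * D) (n : int), G q /\ p = q + (b, d) *~ n.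
have GG' : (G `<=` G')%classic by move=> q Gq; exists q, 0; rewrite mulr0z addr0.
exists G'; last by exists d, (0, 0), 1; rewrite mulr1z add0r.
split=> //; split.
- move=> _ _ [q [n [Gq ->]]] [q' [n' [Gq' ->]]]; exists (q - q'), (n - n').
  by case: Gext => GB _ _; split; [apply: GB | rewrite mulrzBr opprD addrACA].
- move=> e [[x y] [n [Gxy]]]; rewrite pairMz => -[/esym/eqP].
  rewrite addr_eq0 => /eqP xE ->.
  have : G (- x, - y) := Gopp Gxy; rewrite xE opprK => /dP <-.
  by rewrite addrN.
- by move=> _ _ a; apply: GG'; case: Gext => _ _ /(_ _ G00).
Qed.
End OneStep.

(** A maximal partial extension is total: otherwise it could be extended to
    one more element. *)
Lemma divisible_extension : exists g : B -> D,
  (forall x y, g (x + y) = g x + g y) /\ forall a, g (i a) = f a.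
Proof.
have [G [Gext Gf] Gmax] := partial_extension_max.
have G00 : G (0, 0) by have := Gf 0; rewrite !raddf0.
have Gtot x : exists d, G (x, d).
  have [G' [G'ext sub] [d G'd]] := one_step_extension x Gext G00.
  by exists d; apply: Gmax G'd.
have [g gP] := choice Gtot.
have [GB G0 _] := Gext.
have Guniq x y y' : G (x, y) -> G (x, y') -> y = y'.
  move=> Gy Gy'; apply/eqP; rewrite -subr_eq0; apply/eqP/G0.
  by have : G (x - x, y - y') := GB _ _ Gy Gy'; rewrite subrr.
exists g; split=> [x y | a]; last exact: Guniq (gP _) (Gf a).
apply: Guniq (gP _) _.
have : G (x - (0 - y), g x - (0 - g y)) := GB _ _ (gP x) (GB _ _ G00 (gP y)).
by rewrite !add0r !opprK.
Qed.

End DivisibleExtension.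

(** * Enough injective modules *)

Section Coinduced.
Variables (R : pzRingType) (D : zmodType).

(** The coinduced module of additive maps from R to D, with R acting through
    right multiplication on the argument. *)
Record coind := Coind {
  coind_fun :> R -> D;
  coindD : forall x y, coind_fun (x + y) = coind_fun x + coind_fun y }.

Lemma coind_inj (f g : coind) : (forall x, f x = g x) -> f = g.
Proof.
move: f g => [f fD] [g gD] /= /funext e; subst g.
by rewrite (Prop_irrelevance fD gD).
Qed.

HB.instance Definition _ := gen_eqMixin coind.
HB.instance Definition _ := gen_choiceMixin coind.

Fact coind_zeroD (x y : R) : 0 = 0 + 0 :> D. Proof. by rewrite addr0. Qed.
Definition coind_zero := Coind coind_zeroD.
Fact coind_addD (f g : coind) x y :
  f (x + y) + g (x + y) = (f x + g x) + (f y + g y).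
Proof. by rewrite !coindD addrACA. Qed.
Definition coind_add f g := Coind (coind_addD f g).
Fact coind_oppD (f : coind) x y : - f (x + y) = - f x - f y.
Proof. by rewrite coindD opprD. Qed.
Definition coind_opp f := Coind (coind_oppD f).
Fact coind_scaleD a (f : coind) x y : f ((x + y) * a) = f (x * a) + f (y * a).
Proof. by rewrite mulrDl coindD. Qed.
Definition coind_scale a f := Coind (coind_scaleD a f).

Fact coind_addA : associative coind_add.
Proof. by move=> f g h; apply: coind_inj => x /=; rewrite addrA. Qed.
Fact coind_addC : commutative coind_add.
Proof. by move=> f g; apply: coind_inj => x /=; rewrite addrC. Qed.
Fact coind_add0 : left_id coind_zero coind_add.
Proof. by move=> f; apply: coind_inj => x /=; rewrite add0r. Qed.
Fact coind_addN : left_inverse coind_zero coind_opp coind_add.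
Proof. by move=> f; apply: coind_inj => x /=; rewrite addNr. Qed.
HB.instance Definition _ :=
  GRing.isZmodule.Build coind coind_addA coind_addC coind_add0 coind_addN.

Fact coind_scaleA a b v : coind_scale a (coind_scale b v) = coind_scale (a * b) v.
Proof. by apply: coind_inj => x /=; rewrite mulrA. Qed.
Fact coind_scale1 : left_id 1 coind_scale.
Proof. by move=> f; apply: coind_inj => x /=; rewrite mulr1. Qed.
Fact coind_scaleDr : right_distributive coind_scale +%R.
Proof. by move=> a f g; apply: coind_inj. Qed.
Fact coind_scaleDl v : {morph coind_scale^~ v : a b / a + b}.
Proof. by move=> a b; apply: coind_inj => x /=; rewrite mulrDr coindD. Qed.
HB.instance Definition _ := GRing.Zmodule_isLmodule.Build R coind
  coind_scaleA coind_scale1 coind_scaleDr coind_scaleDl.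

Lemma coind_scaleE a (f : coind) x : (a *: f) x = f (x * a).
Proof. by []. Qed.

(** Evaluation at 1 identifies linear maps into the coinduced module with
    additive maps into D, so the injectivity of D as an abelian group is
    inherited. *)
Lemma coind_injective : divisible D -> injective_module coind.
Proof.
move=> Ddiv A B i f i_inj.
have fB : zmod_morphism (fun a => f a 1).
  by move=> x y; rewrite raddfB.
pose f1 : {additive A -> D} := HB.pack (fun a => f a 1)
  (GRing.isZmodMorphism.Build A D (fun a => f a 1) fB).
have [g [gD gi]] := divisible_extension f1 i_inj Ddiv.
have hD b x y : g ((x + y) *: b) = g (x *: b) + g (y *: b).
  by rewrite scalerDl gD.
have hlin : linear (fun b => Coind (hD b)).
  move=> a x y; apply: coind_inj => r /=.
  by rewrite scalerDr gD scalerA.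
exists (linear_map hlin) => a; apply: coind_inj => r /=.
by rewrite -linearZ gi /= linearZ coind_scaleE mul1r.
Qed.

Section Embedding.
Variables (M : lmodType R) (j : {additive M -> D}).

Fact coind_embD m x y : j ((x + y) *: m) = j (x *: m) + j (y *: m).
Proof. by rewrite scalerDl raddfD. Qed.
Fact coind_emb_linear : linear (fun m => Coind (coind_embD m)).
Proof.
move=> a x y; apply: coind_inj => r /=.
by rewrite scalerDr raddfD /= scalerA.
Qed.
Definition coind_emb : {linear M -> coind} := linear_map coind_emb_linear.

Lemma coind_emb_inj : injective j -> injective coind_emb.
Proof.
move=> jinj x y /(congr1 (fun f : coind => f 1)) /=.
by rewrite !scale1r => /jinj.
Qed.
End Embedding.
End Coinduced.

Section DivisibleGroup.
Variable M : zmodType.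
(** Viewed as a module over the integers, because only a subgroup, not a
    rational subspace, is divided out below. *)
Definition rational_span : lmodType int := zmodule (free rat M).

Definition integral_relation (x : rational_span) : Prop :=
  exists2 g : free int M,
    forall m, coef (x : free rat M) m = (coef g m)%:~R &
    extend (id : M -> zmodule M) g = 0.

Fact integral_relation0 : integral_relation 0.
Proof. by exists 0; rewrite ?linear0. Qed.

Fact integral_relation_linear a x y :
  integral_relation x -> integral_relation y -> integral_relation (a *: x + y).
Proof.
move=> [g gx g0] [h hy h0]; exists (a *: g + h) => [m|]; last first.
  by rewrite linearP g0 h0 scaler0 addr0.
rewrite -[LHS]/(coef ((x : free rat M) *~ a + y) m).
rewrite -[RHS]/((a * coef g m + coef h m)%:~R) rmorphD rmorphM /= -gx -hy.
pose c : {linear free rat M -> rat^o} := linear_map (@coef_linear rat _ m).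
by rewrite -[LHS]/(c ((x : free rat M) *~ a + y)) raddfD raddfMz /= -mulrzr mulrC.
Qed.

(** M is the quotient of the free abelian group on the set M by the relations
    that hold in M; dividing the rational vector space on M by the same
    relations gives a divisible group that contains M. *)
Definition divisible_group : zmodType :=
  quo_type (Submodule integral_relation0 integral_relation_linear).

Lemma divisible_group_divisible : divisible divisible_group.
Proof.
move=> n; elim/quoW => x.
exists (quo _ (((n.+1%:R : rat)^-1 *: (x : free rat M)) : rational_span)).
rewrite -[_ *+ _](raddfMn (quo_proj _)); congr (quo _ _).
rewrite -[LHS]/(((n.+1%:R : rat)^-1 *: (x : free rat M)) *+ n.+1).
by rewrite -scaler_nat scalerA mulfV ?scale1r // pnatr_eq0.
Qed.

Definition divisible_fun (m : M) : divisible_group := quo _ (gen rat m : rational_span).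

Fact divisible_fun_additive : zmod_morphism divisible_fun.
Proof.
move=> x y; rewrite -[RHS](raddfB (quo_proj _)); apply/quo_eqP.
exists (gen int (x - y) - (gen int x - gen int y)).
  move=> m; rewrite -[LHS]/((m == x - y)%:R - ((m == x)%:R - (m == y)%:R)).
  rewrite -[X in X%:~R]/((m == x - y)%:R - ((m == x)%:R - (m == y)%:R)).
  by rewrite !rmorphB /= !rmorph_nat.
by rewrite 2!(linearB (extend _)) !extend_gen; apply: subrr.
Qed.

Definition divisible_emb : {additive M -> divisible_group} :=
  HB.pack divisible_fun
    (GRing.isZmodMorphism.Build M divisible_group divisible_fun divisible_fun_additive).

(** A relation with the single term m has integer coefficients equal to the
    indicator of m, and its sum in M is m itself. *)
Lemma divisible_emb_inj : injective divisible_emb.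
Proof.
apply: raddf_inj => m /(quo_proj_eq0 _ _)[g gm g0].
rewrite -g0; have -> : g = gen int m.
  apply: coef_inj => b; apply: (intr_inj (R := rat)).
  by rewrite -gm !coef_gen rmorph_nat.
by rewrite extend_gen.
Qed.

End DivisibleGroup.

Section InjectiveEmbedding.
Variables (R : pzRingType) (M : lmodType R).
Definition inj_module : lmodType R := coind R (divisible_group M).
Definition inj_emb : {linear M -> inj_module} := coind_emb (divisible_emb M).
Lemma inj_module_injective : injective_module inj_module.
Proof. exact/coind_injective/divisible_group_divisible. Qed.
Lemma inj_emb_inj : injective inj_emb.
Proof. exact/coind_emb_inj/divisible_emb_inj. Qed.
Definition cosyzygy : lmodType R := quo_type (im_sub inj_emb).
Definition cosyzygy_proj : {linear inj_module -> cosyzygy} := quo_proj (im_sub inj_emb).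
Lemma cosyzygy_surj : module_surjective cosyzygy_proj.
Proof. exact: quo_proj_surj. Qed.
Lemma cosyzygy_exact : module_exact inj_emb cosyzygy_proj.
Proof. exact: quo_proj_eq0. Qed.
End InjectiveEmbedding.

(** * Null homotopies into purely exact complexes *)

(** Purity of the inclusion of the kernel of D: a finite system of linear
    equations with right-hand sides in the kernel that has a solution in Y has
    one in the kernel. *)
Definition pure_kernel (R : pzRingType) (Y Z : lmodType R) (D : {linear Y -> Z}) : Prop :=
  forall s t (a : 'I_s -> 'I_t -> R) (y : 'I_t -> Y),
    (forall i, D (\sum_j a i j *: y j) = 0) ->
    exists2 z : 'I_t -> Y, forall j, D (z j) = 0 &
      forall i, \sum_j a i j *: z j = \sum_j a i j *: y j.

Section VanishOn.
Variables (R : pzRingType) (C : choiceType) (S : C -> Prop).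

Definition vanish_on (Y : lmodType R) (u : {linear free R C -> Y}) : Prop :=
  forall b, S b -> u (gen R b) = 0.

Definition in_span (x : free R C) : Prop := forall b, b \in supp x -> S b.

Lemma vanish_span (Y : lmodType R) (u : {linear free R C -> Y}) x :
  vanish_on u -> in_span x -> u x = 0.
Proof.
move=> uS xS; rewrite linear_on_supp big1_seq // => b /andP[_ /xS Sb].
by rewrite uS // scaler0.
Qed.

(** Summing over a common list T, and not over the support of x, turns the
    values of u at several x into the equations of one linear system. *)
Lemma linear_on_cover (Y : lmodType R) (u : {linear free R C -> Y}) x (T : seq C) :
  uniq T -> (forall b, b \in supp x -> ~ S b -> b \in T) -> vanish_on u ->
  (forall b, b \in T -> ~ S b) ->
  u x = \sum_(b <- T) coef x b *: u (gen R b).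
Proof.
move=> uT Tx uS TS; pose T' := undup (T ++ supp x).
rewrite linear_on_supp -(@sum_coef_any _ _ _ _ _ T') ?undup_uniq //; last first.
  by move=> b bx; rewrite mem_undup mem_cat bx orbT.
rewrite (bigID (fun b => b \in T)) /= [X in _ + X]big1_seq ?addr0; last first.
  move=> b /andP[bT]; rewrite mem_undup mem_cat (negbTE bT) /= => bx.
  have [Sb|nSb] := pselect (S b); first by rewrite uS ?scaler0.
  by move: bT; rewrite Tx.
rewrite -big_filter; apply: perm_big; apply: uniq_perm => //.
  by rewrite filter_uniq ?undup_uniq.
move=> b; rewrite mem_filter mem_undup mem_cat.
by case: (b \in T).
Qed.

Lemma extend_vanish (Y : lmodType R) (v : C -> Y) :
  vanish_on (extend (fun b => if `[< S b >] then 0 else v b)).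
Proof. by move=> b Sb; rewrite extend_gen asboolT. Qed.

(** The values of z on the generators outside S that occur in xs are the
    unknowns of a finite linear system, of which w is a solution in Y. *)
Lemma pure_extend (Y Z : lmodType R) (D : {linear Y -> Z})
    (w : {linear free R C -> Y}) (xs : seq (free R C)) :
  pure_kernel D -> vanish_on w -> (forall x, x \in xs -> D (w x) = 0) ->
  exists z : {linear free R C -> Y},
    [/\ vanish_on z, forall x, D (z x) = 0 & forall x, x \in xs -> z x = w x].
Proof.
move=> pD wS Dw.
(* T lists the generators that carry the unknowns of the system. *)
pose T := undup [seq b <- flatten (map (@supp R C) xs) | ~~ `[< S b >]].
have uT : uniq T by apply: undup_uniq.
have TS b : b \in T -> ~ S b.
  by rewrite mem_undup mem_filter => /andP[/asboolPn].
have Tx x b : x \in xs -> b \in supp x -> ~ S b -> b \in T.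
  move=> xxs bx /asboolPn nSb; rewrite mem_undup mem_filter nSb.
  by apply/flatten_mapP; exists x.
pose Tt := in_tuple T; pose xt := in_tuple xs.
have wE i : w (tnth xt i) = \sum_j coef (tnth xt i) (tnth Tt j) *: w (gen R (tnth Tt j)).
  rewrite (@linear_on_cover _ w _ T) // => [|b]; last exact/Tx/mem_tnth.
  by rewrite big_tnth.
have [i|z Dz zE] := pD _ _ (fun i j => coef (tnth xt i) (tnth Tt j))
  (fun j => w (gen R (tnth Tt j))).
  by rewrite -wE Dw // mem_tnth.
pose zv b := if insub (index b T) is Some j then z j else 0.
have zvE j : zv (tnth Tt j) = z j.
  rewrite /zv (tnth_nth (tnth Tt j)) /= index_uniq //.
  by rewrite valK.
have Dzv b : D (zv b) = 0 by rewrite /zv; case: insub => [j|]; rewrite ?linear0.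
pose zz := extend (fun b => if `[< S b >] then 0 else zv b).
have zzS : vanish_on zz by apply: extend_vanish.
exists zz; split=> // [x|x xxs].
  rewrite linear_on_supp linear_sum big1 // => b _; rewrite linearZ /zz.
  by rewrite extend_gen; case: ifP => _; rewrite ?Dzv ?linear0; apply: scaler0.
have /tnthP[i ->] : x \in xt by [].
rewrite wE -zE (@linear_on_cover _ zz _ T) // => [|b]; last exact/Tx/mem_tnth.
rewrite big_tnth; apply: eq_bigr => j _; congr (_ *: _).
rewrite -zvE extend_gen asboolF //; apply: TS.
exact: mem_tnth.
Qed.

(** On S the value 0 is a preimage of z under D, because z vanishes there. *)
Lemma vanishing_lift (Y Z : lmodType R) (D : {linear Y -> Z}) (P : C -> Prop)
    (z : {linear free R C -> Z}) :
  vanish_on z -> (forall b, P b -> exists y, D y = z (gen R b)) ->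
  exists2 v : {linear free R C -> Y}, vanish_on v &
    forall b, P b -> D (v (gen R b)) = z (gen R b).
Proof.
move=> zS zP.
have [b|v vP] := @choice C Y (fun b y => P b -> D y = z (gen R b)).
  by have [/zP[y yE]|nP] := pselect (P b); [exists y | exists 0].
exists (extend (fun b => if `[< S b >] then 0 else v b)); first exact: extend_vanish.
move=> b Pb; rewrite extend_gen; case: asboolP => Sb; last exact: vP.
by rewrite linear0 zS.
Qed.

End VanishOn.

Section NullHomotopy.
Variables (R : pzRingType) (B : nat -> choiceType).
Local Notation X i := (free R (B i)).
Variable d : forall i, {linear X i -> X i.+1}.
Hypothesis dd : forall i x, d i.+1 (d i x) = 0.
Variables (Y : nat -> lmodType R) (D : forall i, {linear Y i -> Y i.+1}).
Hypothesis D_exact : forall i, module_exact (D i) (D i.+1).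
Hypothesis D_pure : forall i, pure_kernel (D i.+1).
Variable f : forall i, {linear X i -> Y i.+1}.
Hypothesis f_chain : forall i x, f i.+1 (d i x) = D i.+1 (f i x).

Lemma D_comp0 i x : D i.+1 (D i x) = 0.
Proof. by apply/D_exact; exists x. Qed.

Definition closed_basis (S : forall i, B i -> Prop) : Prop :=
  forall i b, S i b -> in_span (S i.+1) (d i (gen R b)).

Definition homotopy_on (S : forall i, B i -> Prop) (h : forall i, B i -> Y i) :=
  forall i b, S i b ->
    extend (h i.+1) (d i (gen R b)) + D i (h i b) = f i (gen R b).

Section Step.
Variables (S : forall i, B i -> Prop) (h : forall i, B i -> Y i).
Hypotheses (S_closed : closed_basis S) (h_homotopy : homotopy_on S h).
Variable T : forall i, seq (B i).
Hypothesis T_closed : forall i b b', b \in T i -> b' \in supp (d i (gen R b)) ->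
  b' \in T i.+1.

Let S' i b := S b \/ b \in T i.
Let H i : {linear X i -> Y i} :=
  extend (fun b => if `[< S b >] then h b else 0).
(** The obstruction to h, extended by zero outside S, being a homotopy
    everywhere; it vanishes on S and is again a chain map. *)
Fact residual_exists : {g : forall i, {linear X i -> Y i.+1} |
  forall i x, g i x = f i x - (H i.+1 (d i x) + D i (H i x))}.
Proof.
by exists (fun i => sub_map (f i)
  (add_map (comp_map (H i.+1) (d i)) (comp_map (D i) (H i)))).
Qed.
Let g := sval residual_exists.
Let gE i x : g i x = f i x - (H i.+1 (d i x) + D i (H i x)).
Proof. exact: (svalP residual_exists). Qed.

Let HE i (b : B i) : S b -> H i (gen R b) = h b.
Proof. by move=> Sb; rewrite extend_gen asboolT. Qed.

Let H_span i x : in_span (@S i) x -> H i x = extend (@h i) x.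
Proof. by move=> xS; apply: eq_on_gen => b /xS Sb; rewrite HE // extend_gen. Qed.

Lemma residual_vanish i : vanish_on (@S i) (g i).
Proof.
move=> b Sb; rewrite gE HE // H_span; last exact: S_closed.
by rewrite h_homotopy ?subrr.
Qed.

Lemma residual_chain i x : g i.+1 (d i x) = D i.+1 (g i x).
Proof.
by rewrite !gE (linearB (D _)) (linearD (D _)) D_comp0 addr0 dd linear0 add0r f_chain.
Qed.

Definition new_boundaries i := [seq d i (gen R b) | b <- T i].

(** Since g d = D g, the residual g solves in Y a finite system whose
    right-hand sides are in the kernel of D. Purity provides a solution with
    values in that kernel, and v is a lift of it along D. *)
Lemma boundary_correction : exists v : forall i, {linear X i -> Y i},
  (forall i, vanish_on (@S i) (v i)) /\
  forall i b, b \in T i -> D i.+1 (v i.+1 (d i (gen R b))) = D i.+1 (g i (gen R b)).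
Proof.
have step i : exists v : {linear X i.+1 -> Y i.+1}, vanish_on (@S i.+1) v /\
  forall b, b \in T i -> D i.+1 (v (d i (gen R b))) = D i.+1 (g i (gen R b)).
  have [_ /mapP[b bT ->]|z [zS Dz zE]] :=
      pure_extend (@D_pure i.+1) (@residual_vanish i.+1) (xs := new_boundaries i).
    by rewrite residual_chain D_comp0.
  have [|v vS vE] := vanishing_lift (D := D i.+1) (P := fun=> True) zS.
    by move=> b _; apply/D_exact.
  exists v; split=> // b bT; rewrite -residual_chain -zE; last exact: map_f.
  apply: (@eq_on_gen _ _ _ (comp_map (D i.+1) v) z) => b' _.
  by rewrite comp_mapE vE.
pose V i : {linear X i.+1 -> Y i.+1} := projT1 (cid (step i)).
exists (fun i => match i with 0 => @zero_map R (X 0%N) (Y 0%N) | k.+1 => V k end).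
have VP i := projT2 (cid (step i)).
split=> [[|i] | i]; [by move=> b _ | by case: (VP i) | by case: (VP i)].
Qed.

(** With v from boundary_correction, the remainder r = g - (v d + D v) is
    killed by D on T and vanishes on the boundaries d(T). A preimage of r under
    D can be corrected by purity to some q that vanishes on d(T) as well, and
    then h + v + q is a homotopy on the enlarged set. The corrections in
    different degrees do not interact, so no recursion is needed. *)
Lemma extension_step : exists h', homotopy_on S' h' /\ forall i b, S b -> h' i b = h b.
Proof.
have [v [vS vE]] := boundary_correction.
have [r rE] : exists r : forall i, {linear X i -> Y i.+1},
    forall i x, r i x = g i x - (v i.+1 (d i x) + D i (v i x)).
  by exists (fun i => sub_map (g i)
    (add_map (comp_map (v i.+1) (d i)) (comp_map (D i) (v i)))).
have rS i : vanish_on (@S i) (r i).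
  move=> b Sb; rewrite rE residual_vanish // vS // linear0 addr0 sub0r.
  by rewrite (vanish_span (vS i.+1)) ?oppr0 //; apply: S_closed.
have Dr i (b : B i) : b \in T i -> D i.+1 (r i (gen R b)) = 0.
  by move=> bT; rewrite rE (linearB (D _)) (linearD (D _)) D_comp0 addr0 vE ?subrr.
have rd i (b : B i) : b \in T i -> r i.+1 (d i (gen R b)) = 0.
  by move=> bT; rewrite rE residual_chain dd linear0 add0r vE ?subrr.
have lift i : exists2 q : {linear X i -> Y i}, vanish_on (@S i) q &
    forall b, b \in T i -> D i (q (gen R b)) = r i (gen R b).
  by apply: vanishing_lift => // b /Dr/D_exact.
have step i : exists q : {linear X i.+1 -> Y i.+1}, [/\ vanish_on (@S i.+1) q,
    forall b, b \in T i.+1 -> D i.+1 (q (gen R b)) = r i.+1 (gen R b) &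
    forall b, b \in T i -> q (d i (gen R b)) = 0].
  have [q0 q0S q0E] := lift i.+1.
  have q0d b : b \in T i -> D i.+1 (q0 (d i (gen R b))) = 0.
    move=> bT; rewrite -(rd _ _ bT).
    apply: (@eq_on_gen _ _ _ (comp_map (D i.+1) q0) (r i.+1)) => b' b'd.
    by rewrite comp_mapE q0E //; apply: T_closed b'd.
  have [_ /mapP[b bT ->]|z [zS Dz zE]] :=
      pure_extend (@D_pure i) q0S (xs := new_boundaries i).
    exact: q0d.
  exists (sub_map q0 z); split=> b Sb /=.
  - by rewrite zS // q0S // subrr.
  - by rewrite (linearB (D _)) Dz subr0 q0E.
  - by rewrite zE ?subrr //; apply: map_f.
have [q [qS qE qd]] : exists q : forall i, {linear X i -> Y i},
    [/\ forall i, vanish_on (@S i) (q i),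
        forall i b, b \in T i -> D i (q i (gen R b)) = r i (gen R b) &
        forall i b, b \in T i -> q i.+1 (d i (gen R b)) = 0].
  have [q0 q0S q0E] := lift 0%N.
  pose Q i : {linear X i.+1 -> Y i.+1} := projT1 (cid (step i)).
  exists (fun i => match i with 0 => q0 | k.+1 => Q k end).
  have QP i := projT2 (cid (step i)).
  by split=> [[|i]|[|i]|i] //; case: (QP i).
pose h' i (b : B i) : Y i := H i (gen R b) + v i (gen R b) + q i (gen R b).
have h'E i x : extend (@h' i) x = H i x + v i x + q i x.
  apply: (@eq_on_gen _ _ _ _ (add_map (add_map (H i) (v i)) (q i))) => b _.
  by rewrite extend_gen.
exists h'; split=> [i b | i b Sb]; last by rewrite /h' HE // vS // qS // !addr0.
rewrite h'E /h' !(linearD (D _)) addrACA addrA.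
have E1 : H i.+1 (d i (gen R b)) + D i (H i (gen R b)) + g i (gen R b) = f i (gen R b).
  by rewrite gE addrC subrK.
have E2 : v i.+1 (d i (gen R b)) + D i (v i (gen R b)) + r i (gen R b) = g i (gen R b).
  by rewrite rE addrC subrK.
rewrite -E1 -E2.
case=> [Sb | bT].
  rewrite qS // rS // linear0 !addr0 (vanish_span (qS i.+1)) ?addr0; last exact: S_closed.
  by rewrite -!addrA; congr (_ + _); rewrite addrCA.
rewrite qd // addr0 qE // -!addrA; congr (_ + _).
by rewrite addrCA.
Qed.
End Step.

Record partial_homotopy := PartialHomotopy {
  ph_dom : forall i, B i -> Prop;
  ph_fun : forall i, B i -> Y i;
  ph_closed : closed_basis ph_dom;
  ph_eq : homotopy_on ph_dom ph_fun }.

Definition ph_le (s t : partial_homotopy) : Prop :=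
  forall i (b : B i), ph_dom s b -> ph_dom t b /\ ph_fun t b = ph_fun s b.

Lemma ph_empty : exists s : partial_homotopy, True.
Proof.
have c : closed_basis (fun i (_ : B i) => False) by [].
by exists (@PartialHomotopy (fun i _ => False) (fun i _ => 0) c
  (fun i b F => match F with end)).
Qed.

Lemma ph_chain_bound (A : set partial_homotopy) :
  (forall s t, A s -> A t -> ph_le s t \/ ph_le t s) ->
  exists t, forall s, A s -> ph_le s t.
Proof.
move=> Atot.
pose S i (b : B i) := exists2 s, A s & ph_dom s b.
have [h hE] : exists h : forall i, B i -> Y i,
    forall s i (b : B i), A s -> ph_dom s b -> h i b = ph_fun s b.
  exists (fun i b => if pselect (S i b) is left e then ph_fun (projT1 (cid2 e)) b else 0).
  move=> s i b As sb; case: pselect => [e|[]]; last by exists s.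
  case: cid2 => t /= At tb.
  by case: (Atot _ _ As At) => [/(_ i b sb)[_ ->] | /(_ i b tb)[_ ->]].
have S_closed : closed_basis S.
  by move=> i b [s As sb] b' /(ph_closed sb) sb'; exists s.
have S_eq : homotopy_on S h.
  move=> i b [s As sb]; rewrite -(ph_eq sb) (hE _ _ _ As sb); congr (_ + _).
  apply: eq_on_gen => b' b'd; rewrite !extend_gen; apply: hE => //.
  exact: ph_closed sb _ b'd.
by exists (PartialHomotopy S_closed S_eq) => s As i b sb; split; [exists s | apply: hE].
Qed.

(** The smallest family that contains T0 and all the generators occurring in
    the differentials of its members. It is finite in each degree because the
    differential raises the degree and degrees start at 0. *)
Fixpoint basis_closure (T0 : forall i, seq (B i)) (i : nat) : seq (B i) :=
  match i with
  | 0 => T0 0%N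
  | k.+1 => T0 k.+1 ++ flatten [seq supp (d k (gen R b)) | b <- basis_closure T0 k]
  end.

(** The indices of Y are shifted by one, so that Y 0, which is to be taken to
    be zero, makes room for the lowest component of the homotopy. *)
Theorem null_homotopic : exists h : forall i, {linear X i -> Y i},
  forall i x, h i.+1 (d i x) + D i (h i x) = f i x.
Proof.
have [t0 _] := ph_empty.
have [|||[S h Sc hE] tmax] := @ZL_preorder _ t0 (fun s t => `[< ph_le s t >]).
- by move=> t; apply/asboolP.
- move=> r s t /asboolP rs /asboolP st; apply/asboolP => i b /rs[/st[tb <-] e].
  by rewrite e.
- move=> A Atot; have [s t As At|t tP] := @ph_chain_bound A.
    by case: (Atot _ _ As At) => /asboolP; auto.
  by exists t => s /tP ?; apply/asboolP.
have Stot j (b : B j) : S j b.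
  pose T0 i : seq (B i) :=
    if pselect (j = i) is left e then [:: ecast k (B k) e b] else [::].
  pose T := basis_closure T0.
  have Tb : b \in T j.
    have : b \in T0 j.
      rewrite /T0; case: pselect => // e; rewrite (Prop_irrelevance e erefl) /=.
      by rewrite inE.
    by rewrite /T; case: (j) (b) => [|k] b' //= b'T; rewrite mem_cat b'T.
  have Tc i (c : B i) c' : c \in T i -> c' \in supp (d i (gen R c)) -> c' \in T i.+1.
    move=> cT c'd; rewrite /T /= mem_cat; apply/orP; right.
    by apply/flatten_mapP; exists c.
  have [h' [h'E h'S]] := extension_step Sc hE Tc.
  have S'c : closed_basis (fun i (c : B i) => S i c \/ c \in T i).
    by move=> i c [Sb|cT] c' c'd; [left; apply: Sc Sb _ c'd | right; apply: Tc c'd].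
  have /tmax/asboolP/(_ j b)[|//] :
      `[< ph_le (PartialHomotopy Sc hE) (PartialHomotopy S'c h'E) >].
    by apply/asboolP => i c Sb; split; [left | apply: h'S].
  by right.
exists (fun i => extend (@h i)) => i x.
pose l := add_map (comp_map (extend (@h i.+1)) (d i)) (comp_map (D i) (extend (@h i))).
apply: (@eq_on_gen _ _ _ l) => b _; rewrite -hE //.
by rewrite /l -[LHS]/(_ + D i (extend _ _)) extend_gen.
Qed.

End NullHomotopy.

(** * Vanishing of the first extension group *)

Section Ext1.
Variable R : pzRingType.
Implicit Types A B C D I J K M N P : lmodType R.

Definition short_exact A B C (i : {linear A -> B}) (p : {linear B -> C}) : Prop :=
  is_kernel i p /\ module_surjective p.

(** The vanishing of Ext^1(J, N), expressed by the extension of maps along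
    all monomorphisms with cokernel J. No resolution is chosen, so it can be
    applied to any exact sequence at hand. *)
Definition Ext1_vanishes J N : Prop :=
  forall A B (i : {linear A -> B}) (p : {linear B -> J}), short_exact i p ->
  forall f : {linear A -> N}, exists h : {linear B -> N}, forall x, h (i x) = f x.

Lemma exact_comp_surj A B C D (p : {linear D -> A}) (f : {linear A -> B})
    (g : {linear B -> C}) :
  module_surjective p -> module_exact f g -> module_exact (comp_map f p) g.
Proof.
move=> ps fg y; apply: (iff_trans (fg y)).
by split=> [[x <-] | [x <-]]; [have [x' <-] := ps x; exists x' | exists (p x)].
Qed.

Lemma exact_comp_inj A B C D (f : {linear A -> B}) (g : {linear B -> C})
    (i : {linear C -> D}) :
  injective i -> module_exact f g -> module_exact f (comp_map i g).
Proof.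
move=> iinj fg y; apply: iff_trans _ (fg y).
split=> [igy | gy]; first by apply: iinj; rewrite linear0.
by rewrite comp_mapE gy linear0.
Qed.

Lemma coimage_factor A B C (f : {linear A -> B}) (g : {linear B -> C}) :
  module_exact f g ->
  exists g' : {linear quo_type (im_sub f) -> C},
    injective g' /\ forall x, g' (quo_proj (im_sub f) x) = g x.
Proof.
move=> fg; have qs := @quo_proj_surj _ _ (im_sub f).
have [|g' g'E] := factor_surj (f := g) qs; first by move=> x /quo_proj_eq0/fg.
exists g'; split=> // x y; have [x' <-] := qs x; have [y' <-] := qs y.
rewrite !g'E => e; apply/eqP; rewrite -subr_eq0 -linearB.
by apply/eqP/quo_proj_eq0/fg; rewrite linearB e subrr.
Qed.

Lemma kernel_lift A B C D (i : {linear A -> B}) (p : {linear B -> C})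
    (f : {linear D -> B}) :
  is_kernel i p -> (forall x, p (f x) = 0) ->
  exists h : {linear D -> A}, forall x, i (h x) = f x.
Proof. by move=> [iinj ex] pf; apply: lift_inj => // x; apply/ex. Qed.

Lemma short_exact_comp0 A B C (i : {linear A -> B}) (p : {linear B -> C}) x :
  is_kernel i p -> p (i x) = 0.
Proof. by move=> [_ ex]; apply/ex; exists x. Qed.

Lemma cokernel_factor A B C D (i : {linear A -> B}) (p : {linear B -> C})
    (f : {linear B -> D}) :
  short_exact i p -> (forall x, f (i x) = 0) ->
  exists h : {linear C -> D}, forall x, h (p x) = f x.
Proof.
move=> [[_ ex] ps] fi; apply: factor_surj => // x /ex[y <-]; exact: fi.
Qed.

(** Any extension B of J by A is the pushout of the presentation along a map
    K -> A, so a map on A and an extension to P of its pullback to K glue to a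
    map on B. *)
Lemma Ext1_of_presentation J N K P (k : {linear K -> P}) (q : {linear P -> J}) :
  projective P -> short_exact k q ->
  (forall f : {linear K -> N}, exists h : {linear P -> N}, forall x, h (k x) = f x) ->
  Ext1_vanishes J N.
Proof.
move=> Pproj [[kinj kex] qs] Hext A B i p [ker_ip ps] f.
have [c cE] := Pproj _ _ p q ps.
have [|c' c'E] := kernel_lift (f := comp_map c k) ker_ip.
  by move=> x; rewrite comp_mapE cE; apply/kex; exists x.
have [m mE] := Hext (comp_map f c').
(* s presents B as the pushout, and t is the map to be pushed down. *)
pose s : {linear (A * P)%type -> B} :=
  add_map (comp_map i (fst_map A P)) (comp_map c (snd_map A P)).
pose t : {linear (A * P)%type -> N} :=
  add_map (comp_map f (fst_map A P)) (comp_map m (snd_map A P)).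
have ss : module_surjective s.
  move=> y; have [x xE] := qs (p y).
  have /(proj2 ker_ip)[a aE] : p (y - c x) = 0 by rewrite linearB /= cE xE subrr.
  by exists (a, x); rewrite -[LHS]/(i a + c x) aE subrK.
have [|h hE] := factor_surj (g := s) (f := t) ss.
  move=> [a x]; rewrite -[s _]/(i a + c x) -[t _]/(f a + m x) => e.
  have /kex[y yx] : q x = 0.
    by have := congr1 p e; rewrite linearD linear0 cE (short_exact_comp0 _ ker_ip) add0r.
  have /(proj1 ker_ip) : i (a + c' y) = i 0 by rewrite linearD c'E comp_mapE yx linear0.
  by move/(canRL (addrK _)) => ->; rewrite -yx mE comp_mapE sub0r linearN addNr.
exists h => x; have := hE (x, 0).
by rewrite -[s _]/(i x + c 0) -[t _]/(f x + m 0) !linear0 !addr0.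
Qed.

Lemma image_factor A B (d : {linear A -> B}) :
  exists2 d' : {linear A -> sub_type (im_sub d)}, module_surjective d' &
    forall x, sub_incl (im_sub d) (d' x) = d x.
Proof.
have [d' d'E] : exists d' : {linear A -> sub_type (im_sub d)},
    forall x, sub_incl (im_sub d) (d' x) = d x.
  apply: lift_inj; first exact: sub_val_inj.
  by move=> x; exists (@SubElt _ _ (im_sub d) (d x) (ex_intro _ x erefl)).
exists d' => // -[y [x xE]]; exists x; apply: sub_val_inj.
by rewrite -[LHS]/(sub_incl _ _) d'E.
Qed.

Lemma quotient_short_exact M (K : submodule M) : short_exact (sub_incl K) (quo_proj K).
Proof.
split; last exact: quo_proj_surj; split; first exact: sub_val_inj.
move=> x; split=> [/quo_proj_eq0 xim | [[z zim] <-]]; last exact/quo_proj_eq0.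
by exists (@SubElt _ _ K x xim).
Qed.

Lemma kernel_short_exact A B (f : {linear A -> B}) :
  module_surjective f -> short_exact (sub_incl (ker_sub f)) f.
Proof. by split=> //; apply: ker_sub_kernel. Qed.

Lemma extend_along A B I (d : {linear A -> B}) (f : {linear A -> I}) :
  injective_module I -> (forall x, d x = 0 -> f x = 0) ->
  exists h : {linear B -> I}, forall x, h (d x) = f x.
Proof.
move=> Iinj kerd.
have [d' d's d'E] := image_factor d.
have [|f' f'E] := factor_surj (f := f) d's.
  by move=> x d'x; apply: kerd; rewrite -d'E d'x linear0.
have [h hE] := Iinj _ _ (sub_incl (im_sub d)) f' (@sub_val_inj _ _ _).
by exists h => x; rewrite -d'E hE f'E.
Qed.

End Ext1.

Section Resolutions.
Variable R : pzRingType.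

Section Cons.
Variables (P : lmodType R) (X : nat -> lmodType R).
(** Prepending a term to a complex; with the index shift done by matching,
    the remaining terms and differentials are unchanged definitionally. *)
Definition cons_mod (n : nat) : lmodType R := match n with 0 => P | k.+1 => X k end.
Definition cons_down (f : {linear X 0%N -> P})
    (d : forall n, {linear X n.+1 -> X n}) (n : nat) :
    {linear cons_mod n.+1 -> cons_mod n} :=
  match n with 0 => f | k.+1 => d k end.
Definition cons_up (f : {linear P -> X 0%N})
    (d : forall n, {linear X n -> X n.+1}) (n : nat) :
    {linear cons_mod n -> cons_mod n.+1} :=
  match n with 0 => f | k.+1 => d k end.
End Cons.

Lemma left_resolution_cons (K P M : lmodType R)
    (i : {linear K -> P}) (p : {linear P -> M}) (X : nat -> lmodType R)
    (d : forall n, {linear X n.+1 -> X n}) (e : {linear X 0%N -> K}) :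
  short_exact i p -> left_resolution d e ->
  left_resolution (cons_down (comp_map i e) d) (p : {linear cons_mod P X 0 -> M}).
Proof.
move=> [[iinj iex] ps] [es e0 ex]; split=> // [|[|n]]; last exact: ex.
  exact: exact_comp_surj.
exact: exact_comp_inj.
Qed.

Lemma syzygy_short_exact (M : lmodType R) : short_exact (syzygy_incl M) (free_cover M).
Proof. by split; [apply: syzygy_kernel | apply: free_cover_surj]. Qed.

Lemma free_resolution (M : lmodType R) :
  exists (X : nat -> lmodType R) (d : forall n, {linear X n.+1 -> X n})
         (e : {linear X 0%N -> M}),
    (forall n, projective (X n)) /\ left_resolution d e.
Proof.
pose s n := iter n (@syzygy R) M.
exists (fun n => free R (s n)).
exists (fun n => comp_map (syzygy_incl (s n)) (free_cover (s n.+1))).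
exists (free_cover M); split=> [n|]; first exact: free_projective.
have sex n : module_exact (comp_map (syzygy_incl (s n)) (free_cover (s n.+1)))
    (free_cover (s n)).
  by apply: exact_comp_surj; [apply: free_cover_surj | case: (syzygy_kernel (s n))].
split=> [||n]; [exact: free_cover_surj | exact: (sex 0%N) |].
by apply: exact_comp_inj (sex n.+1); case: (syzygy_kernel (s n)).
Qed.

End Resolutions.

Lemma row_projective (R : pzRingType) n : projective ('rV[R]_n : lmodType R).
Proof.
move=> A B g f gs; have [a aE] := choice (fun j => gs (f (delta_mx 0 j))).
have hlin : linear (fun v : 'rV[R]_n => \sum_j v 0 j *: a j).
  move=> c u v; rewrite scaler_sumr -big_split; apply: eq_bigr => i _ /=.
  by rewrite !mxE scalerDl scalerA.
exists (linear_map hlin) => v; rewrite [in RHS](row_sum_delta v) !linear_sum.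
by apply: eq_bigr => j _; rewrite !linearZ /= aE.
Qed.

Section StronglyFPInjective.
Variable R : pzRingType.

(** The matrix of a system of equations presents a finitely presented module
    F. The right-hand sides define a map on the relations of F, and it extends
    to the free module because Ext^1(F, E) = 0; the extension is a solution. *)
Lemma SFI_pure (E Y Z : lmodType R) (j : {linear E -> Y}) (D : {linear Y -> Z}) :
  strongly_FP_injective E -> injective j -> module_exact j D -> pure_kernel D.
Proof.
move=> SE jinj jD s t a y Da.
have [e eE] : exists e : 'I_s -> E, forall i, j (e i) = \sum_k a i k *: y k.
  have [|e eE] := @choice _ _ (fun i x => j x = \sum_k a i k *: y k).
    by move=> i; apply/jD.
  by exists e.
pose A : 'M[R]_(s, t) := \matrix_(i, k) a i k.
have alin : linear (fun v : 'rV[R]_s => v *m A).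
  by move=> c u v; rewrite mulmxDl -scalemxAl.
pose al := linear_map alin.
have ulin : linear (fun v : 'rV[R]_s => \sum_i v 0 i *: e i).
  move=> c u v; rewrite scaler_sumr -big_split; apply: eq_bigr => i _ /=.
  by rewrite !mxE scalerDl scalerA.
pose u := linear_map ulin.
have uE v : j (u v) = \sum_k (v *m A) 0 k *: y k.
  rewrite linear_sum; under eq_bigr do rewrite linearZ /= eE scaler_sumr.
  rewrite exchange_big; apply: eq_bigr => k _; rewrite mxE scaler_suml.
  by apply: eq_bigr => i _; rewrite !mxE scalerA.
pose F := quo_type (im_sub al).
have Ffp : finitely_presented F.
  exists s, t, al, (quo_proj (im_sub al)); split; first exact: quo_proj_surj.
  exact: quo_proj_eq0.
have [al' al's al'E] := image_factor al.
have s1 := kernel_short_exact al's.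
have s2 : short_exact (sub_incl (im_sub al)) (quo_proj (im_sub al)).
  exact: quotient_short_exact.
have [X [d [ep [Xp res]]]] := free_resolution (sub_type (ker_sub al')).
have res1 := left_resolution_cons s2 (left_resolution_cons s1 res).
have Wp k :
    projective (cons_mod ('rV[R]_t : lmodType R) (cons_mod ('rV[R]_s : lmodType R) X) k).
  by case: k => [|[|k]] //=; apply: row_projective.
have [ext _] := SE 0%N F Ffp _ _ _ Wp res1 u.
have u0 (w : 'rV[R]_s) : al' w = 0 -> u w = 0.
  move=> w0; have wA : al w = 0 by rewrite -al'E w0 linear0.
  apply: jinj; rewrite uE linear0; apply: big1 => k _.
  by rewrite -[w *m A]/(al w) wA mxE scale0r.
have [v|k kE] := ext.
  exact: (u0 (sub_incl _ (ep v)) (short_exact_comp0 (ep v) (proj1 s1))).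
exists (fun l => j (k (delta_mx 0 l))) => [l|i]; first by apply/jD; eexists.
have aE : u (delta_mx 0 i) = k (al (delta_mx 0 i)).
  by rewrite -al'E; apply/esym/(kE (delta_mx 0 i)).
have uj : j (u (delta_mx 0 i)) = \sum_l a i l *: y l.
  rewrite uE; apply: eq_bigr => l _; congr (_ *: _).
  by rewrite -rowE !mxE.
rewrite -uj aE /= -rowE (row_sum_delta (row i A)) !linear_sum.
by apply: eq_bigr => l _; rewrite !linearZ /= !mxE.
Qed.

End StronglyFPInjective.

(** * Strongly FP-injective modules are orthogonal to right projective ones *)

Section Cosyzygies.
Variable R : pzRingType.

(** Dimension shifting, Ext^k(F, N') = Ext^(k+1)(F, N) for k > 0, carried out on
    cocycles of an arbitrary projective resolution of F. *)
Lemma SFI_cosyzygy (N I N' : lmodType R) (i : {linear N -> I}) (p : {linear I -> N'}) :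
  strongly_FP_injective N -> injective_module I -> short_exact i p ->
  strongly_FP_injective N'.
Proof.
move=> SN Iinj [ker_ip ps] k F Ffp X d e Xp res u.
have dd n x : d n (d n.+1 x) = 0 by case: res => _ _ ex; apply/ex; exists x.
split=> [ud|[w wE] x]; last by rewrite -wE dd linear0.
have [v vE] := Xp _ _ _ p u ps.
have [|v' v'E] := kernel_lift (f := comp_map v (d k.+1)) ker_ip.
  by move=> x; rewrite comp_mapE vE ud.
have [ext _] := SN k.+1 F Ffp X d e Xp res v'.
have [x|w wE] := ext.
  by apply: (proj1 ker_ip); rewrite v'E comp_mapE dd !linear0.
have [x dx|t tE] := extend_along (d := d k) (f := sub_map v (comp_map i w)) Iinj.
  have [_ _ /(_ k x)[/(_ dx)[y <-] _]] := res.
  by rewrite /= wE v'E comp_mapE subrr.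
exists (comp_map p t) => x.
by rewrite comp_mapE tE /= linearB /= vE (short_exact_comp0 _ ker_ip) subr0.
Qed.

Definition cosyzygies (n : nat) (M : lmodType R) : lmodType R := iter n (@cosyzygy R) M.

Lemma cosyzygy_short_exact (M : lmodType R) : short_exact (inj_emb M) (cosyzygy_proj M).
Proof.
by split; [split; [apply: inj_emb_inj | apply: cosyzygy_exact] | apply: cosyzygy_surj].
Qed.

Lemma cosyzygies_SFI n (E : lmodType R) :
  strongly_FP_injective E -> strongly_FP_injective (cosyzygies n E).
Proof.
move=> SE; elim: n => [|n IH] //=.
exact: SFI_cosyzygy IH (@inj_module_injective R _) (cosyzygy_short_exact _).
Qed.

Definition right_projective (Z : lmodType R) : Prop :=
  exists (X : nat -> lmodType R) (d : forall n, {linear X n -> X n.+1})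
         (e : {linear Z -> X 0%N}),
    (forall n, projective (X n)) /\ right_resolution d e.

Section InjectiveCoresolution.
Variable E : lmodType R.
Let Y (n : nat) : lmodType R :=
  match n with
  | 0 => zero_mod R
  | 1 => E
  | k.+2 => inj_module (cosyzygies k E)
  end.
Let D (n : nat) : {linear Y n -> Y n.+1} :=
  match n with
  | 0 => zero_map _ E
  | 1 => inj_emb E
  | k.+2 => comp_map (inj_emb (cosyzygies k.+1 E)) (cosyzygy_proj (cosyzygies k E))
  end.

Let inj_exact k : module_exact (inj_emb (cosyzygies k E)) (D k.+2).
Proof. by apply: exact_comp_inj; [apply: inj_emb_inj | apply: cosyzygy_exact]. Qed.

Let D_exact n : module_exact (D n) (D n.+1).
Proof.
case: n => [|[|n]] y; last 2 first.
- exact: (@inj_exact 0).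
- exact: (exact_comp_surj (@cosyzygy_surj _ _) (@inj_exact n.+1)).
split=> [e | [x <-]]; last by rewrite linear0.
by exists 0; apply: inj_emb_inj; rewrite e linear0.
Qed.

Let D_pure n : strongly_FP_injective E -> pure_kernel (D n.+1).
Proof.
move=> SE; case: n => [|n].
  move=> s t a y Da; exists (fun=> 0) => [j|i]; first by rewrite linear0.
  apply: inj_emb_inj; rewrite Da big1 ?linear0 // => j _.
  exact: scaler0.
exact: SFI_pure (@cosyzygies_SFI n E SE) (@inj_emb_inj _ _) (@inj_exact n).
Qed.

Variables (W : nat -> lmodType R) (d : forall n, {linear W n -> W n.+1}).
Hypothesis W_projective : forall n, projective (W n).
Hypothesis W_exact : forall n, module_exact (d n) (d n.+1).
Variable u : {linear W 0%N -> E}.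
Hypothesis u_ker : forall x, d 0%N x = 0 -> u x = 0.

Let good n (f : {linear W n -> Y n.+1}) := forall x, d n x = 0 -> D n.+1 (f x) = 0.

Let chain_step n (f : {linear W n -> Y n.+1}) : good f ->
  exists g : {linear W n.+1 -> Y n.+2}, good g /\ forall x, g (d n x) = D n.+1 (f x).
Proof.
move=> gf; have [||g gE] := @extend_along _ _ _ (Y n.+2) (d n) (comp_map (D n.+1) f).
- exact: inj_module_injective.
- by move=> x /gf.
exists g; split=> // x /(W_exact x)[y <-]; rewrite gE; apply/D_exact.
by exists (f y).
Qed.

Let chain_map : exists f : forall n, {linear W n -> Y n.+1},
  f 0%N = u /\ forall n x, f n.+1 (d n x) = D n.+1 (f n x).
Proof.
have u_good : @good 0 u by move=> x /u_ker ->; rewrite linear0.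
pose F := fix F n : {f : {linear W n -> Y n.+1} | good f} :=
  match n with
  | 0 => exist _ u u_good
  | k.+1 => let f := F k in let g := cid (chain_step (svalP f)) in
            exist _ (sval g) (proj1 (svalP g))
  end.
exists (fun n => sval (F n)); split=> // n x /=.
exact: (proj2 (svalP (cid (chain_step (svalP (F n)))))).
Qed.

(** The map u extends to a chain map into the injective coresolution of E,
    and the lowest component of a null homotopy of it extends u. Each
    projective W^n is a retract of a free module F^n; carrying the differential over to the F^n gives a complex which
    need not be exact, but null_homotopic does not ask for exactness. *)
Lemma SFI_extension : strongly_FP_injective E ->
  exists h : {linear W 1%N -> E}, forall x, h (d 0%N x) = u x.
Proof.
move=> SE; have [f [f0 fE]] := chain_map.
have sec n : exists s : {linear W n -> free R (W n)},
    forall x, free_cover (W n) (s x) = x.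
  have [s sE] := W_projective (id_map (W n)) (@free_cover_surj R (W n)).
  by exists s => x; rewrite sE.
pose s n := sval (cid (sec n)).
have sK n x : free_cover (W n) (s n x) = x by rewrite /s; case: cid.
(* dF is a differential because the section s n is split by the cover. *)
pose dF n : {linear free R (W n) -> free R (W n.+1)} :=
  comp_map (s n.+1) (comp_map (d n) (free_cover (W n))).
pose fF n : {linear free R (W n) -> Y n.+1} := comp_map (f n) (free_cover (W n)).
have [n x|n|n x|h hE] := @null_homotopic R W dF _ Y D D_exact _ fF.
- rewrite !comp_mapE sK (_ : d n.+1 _ = 0) ?linear0 //.
  by apply/W_exact; eexists.
- exact: D_pure.
- by rewrite !comp_mapE sK fE.
exists (comp_map (h 1%N) (s 1%N)) => x; have := hE 0%N (s 0%N x).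
by rewrite !comp_mapE sK f0 addr0.
Qed.

End InjectiveCoresolution.

(** A free presentation of Z, preceded by a free cover of the syzygy and
    followed by the coresolution of Z, is an exact complex of projectives to
    which SFI_extension applies. *)
Theorem Ext1_right_projective_SFI (Z E : lmodType R) :
  right_projective Z -> strongly_FP_injective E -> Ext1_vanishes Z E.
Proof.
move=> [X [d [e [Xp [einj ex0 ex]]]]] SE.
apply: (Ext1_of_presentation (free_projective R Z) (syzygy_short_exact Z)) => f.
pose W := cons_mod (free R (syzygy Z)) (cons_mod (free R Z) X).
pose dW : forall n, {linear W n -> W n.+1} :=
  cons_up (comp_map (syzygy_incl Z) (free_cover (syzygy Z))
    : {linear free R (syzygy Z) -> cons_mod (free R Z) X 0})
    (cons_up (comp_map e (free_cover Z)) d).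
have Wp n : projective (W n)
  by case: n => [|[|n]];
    [exact: (free_projective R (syzygy Z)) | exact: (free_projective R Z) | exact: Xp].
have [[sinj sex] _] := syzygy_short_exact Z.
have Wex n : module_exact (dW n) (dW n.+1).
  case: n => [|[|n]]; last exact: ex.
  all: try exact: exact_comp_surj (@free_cover_surj _ Z) ex0.
  by apply: exact_comp_inj => //; apply: exact_comp_surj; first exact: free_cover_surj.
have [x|h hE] := @SFI_extension E W dW Wp Wex (comp_map f (free_cover _)) _ SE.
  rewrite comp_mapE -(linear0 (syzygy_incl Z)) => /sinj e0.
  by rewrite comp_mapE e0 linear0.
exists h => k; have [x <-] := free_cover_surj k.
by rewrite -[LHS]/(h (dW 0%N x)) hE.
Qed.

End Cosyzygies.

(** * The modules orthogonal to right projective modules *)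

Section RightProjective.
Variable R : pzRingType.
Implicit Types A B C E K L M N P Q Z U : lmodType R.

Lemma right_resolution_tail M (X : nat -> lmodType R)
    (d : forall n, {linear X n -> X n.+1}) (e : {linear M -> X 0%N}) :
  right_resolution d e ->
  exists e' : {linear quo_type (im_sub e) -> X 1%N},
    right_resolution (fun n => d n.+1) e'.
Proof.
move=> [einj ex0 ex]; have [e' [e'inj e'E]] := coimage_factor ex0.
exists e'; split=> // y.
apply: (iff_trans (ex 0%N y)); split=> [[x <-] | [x <-]]; first by exists (quo_proj _ x).
by have [x' <-] := quo_proj_surj x; exists x'.
Qed.

Lemma right_projective_cosyzygy Z : right_projective Z ->
  exists P Z' (i : {linear Z -> P}) (p : {linear P -> Z'}),
    [/\ projective P, short_exact i p & right_projective Z'].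
Proof.
move=> [X [d [e [Xp res]]]]; have [e' res'] := right_resolution_tail res.
exists (X 0%N), (quo_type (im_sub e)), e, (quo_proj (im_sub e)); split=> //.
  case: res => einj _ _; split; last exact: quo_proj_surj.
  by split=> //; apply: quo_proj_eq0.
by exists (fun n => X n.+1), (fun n => d n.+1), e'.
Qed.

Lemma right_projective_cons Z P Z' (i : {linear Z -> P}) (p : {linear P -> Z'}) :
  projective P -> short_exact i p -> right_projective Z' -> right_projective Z.
Proof.
move=> Pp [[iinj iex] ps] [X [d [e [Xp [einj ex0 ex]]]]].
exists (cons_mod P X), (cons_up (comp_map e p) d), i.
split=> [[|n]|]; [exact: Pp | exact: Xp |]; split=> // [|[|n]]; last exact: ex.
  exact: exact_comp_inj.
exact: exact_comp_surj.
Qed.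

Definition right_projective_perp N : Prop :=
  forall Z, right_projective Z -> Ext1_vanishes Z N.

Lemma perp_zero N : zero_module N -> right_projective_perp N.
Proof.
by move=> N0 Z _ A B i p _ f; exists (zero_map B N) => x; rewrite [RHS]N0.
Qed.

(** A map Z -> N' extends to the projective term P of the coresolution of Z,
    as the cokernel Z' is right projective too, and so lifts to E. Hence
    Ext^1(Z, N) embeds in Ext^1(Z, E). *)
Lemma perp_kernel N E N' (j : {linear N -> E}) (q : {linear E -> N'}) :
  short_exact j q -> right_projective_perp E -> right_projective_perp N' ->
  right_projective_perp N.
Proof.
move=> [ker_jq qs] pE pN' Z rZ A B i p sip f.
have [P [Z' [i' [p' [Pp s' rZ']]]]] := right_projective_cosyzygy rZ.
have [g gE] := pE Z rZ _ _ i p sip (comp_map j f).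
have [x|phi phiE] := cokernel_factor (f := comp_map q g) sip.
  by rewrite comp_mapE gE comp_mapE (short_exact_comp0 _ ker_jq).
have [psi psiE] := pN' Z' rZ' _ _ i' p' s' phi.
have [t tE] := Pp _ _ q psi qs.
have [x|h hE] := kernel_lift (f := sub_map g (comp_map t (comp_map i' p))) ker_jq.
  by rewrite /= linearB tE psiE phiE subrr.
exists h => x; apply: (proj1 ker_jq).
by rewrite hE /= gE (short_exact_comp0 _ (proj1 sip)) (linear0 i') (linear0 t) subr0.
Qed.

Lemma right_projective_syzygy Z : right_projective Z -> right_projective (syzygy Z).
Proof.
exact: right_projective_cons (free_projective R Z) (syzygy_short_exact Z).
Qed.

(** The pullback of j and q along f is an extension of Z by N; a splitting of
    it is a lift of f. *)
Lemma Ext1_lift Z N E N' (j : {linear N -> E}) (q : {linear E -> N'})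
    (f : {linear Z -> N'}) :
  short_exact j q -> Ext1_vanishes Z N ->
  exists g : {linear Z -> E}, forall x, q (g x) = f x.
Proof.
move=> [ker_jq qs] ext.
pose diff : {linear (Z * E)%type -> N'} :=
  sub_map (comp_map f (fst_map Z E)) (comp_map q (snd_map Z E)).
(* G is the pullback of q along f. *)
pose G := sub_type (ker_sub diff).
pose p : {linear G -> Z} := comp_map (fst_map Z E) (sub_incl _).
pose s : {linear G -> E} := comp_map (snd_map Z E) (sub_incl _).
have sE x : q (s x) = f (p x).
  by case: x => x xd; apply/esym/subr0_eq.
have [|i iE] := kernel_lift (f := comp_map (inr_map Z E) j) (ker_sub_kernel diff).
  by move=> n; rewrite -[LHS]/(f 0 - q (j n)) linear0 (short_exact_comp0 _ ker_jq) subrr.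
have iE' n : p (i n) = 0 /\ s (i n) = j n.
  by split; rewrite comp_mapE iE.
have sip : short_exact i p.
  split; last first.
    move=> z; have [e ez] := qs (f z).
    have d0 : diff (z, e) = 0 by rewrite -[LHS]/(f z - q e) ez subrr.
    by exists (@SubElt _ _ (ker_sub diff) (z, e) d0).
  split=> [x y /(congr1 s)|y].
    by rewrite !(proj2 (iE' _)) => /(proj1 ker_jq).
  split=> [py0 | [n <-]]; last by rewrite (proj1 (iE' _)).
  have /(proj2 ker_jq)[n nE] : q (s y) = 0 by rewrite sE py0 linear0.
  exists n; apply: sub_val_inj; rewrite -[LHS]/(sub_incl _ (i n)) iE /= nE.
  by rewrite -[X in (X, _)]py0 -[RHS]/(sub_incl _ y) /p /s /=; case: (sub_val y).
have [r rE] := ext _ _ _ _ sip (id_map N).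
have ps := proj2 sip.
have [|g gE] := factor_surj (f := sub_map s (comp_map j r)) ps.
  move=> x /(proj2 (proj1 sip))[n <-].
  by rewrite -[LHS]/(s (i n) - j (r (i n))) rE (proj2 (iE' n)) subrr.
exists g => z; have [x <-] := ps z.
by rewrite gE -[LHS]/(q (s x - j (r x))) linearB sE (short_exact_comp0 _ ker_jq) subr0.
Qed.

(** The obstruction lies in Ext^2(Z, K), which is Ext^1 of the syzygy of Z, a
    right projective module. *)
Lemma perp_cokernel K Q U (j : {linear K -> Q}) (q : {linear Q -> U}) :
  short_exact j q -> right_projective_perp K -> right_projective_perp Q ->
  right_projective_perp U.
Proof.
move=> sjq pK pQ Z rZ.
apply: (Ext1_of_presentation (free_projective R Z) (syzygy_short_exact Z)) => f.
have [g gE] := Ext1_lift f sjq (pK _ (right_projective_syzygy rZ)).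
have [h hE] := pQ Z rZ _ _ _ _ (syzygy_short_exact Z) g.
by exists (comp_map q h) => x; rewrite comp_mapE hE gE.
Qed.

(** Induction on the length of the coresolution, through perp_kernel. *)
Lemma perp_SFI_vee N : SFI_vee N -> right_projective_perp N.
Proof.
move=> [m]; elim: m N => [|m IH] N [X [d [e [res XS X0]]]].
  all: have [e' res'] := right_resolution_tail res.
  all: have se : short_exact e (quo_proj (im_sub e)) by
    split; [split; [case: res | apply: quo_proj_eq0] | apply: quo_proj_surj].
  all: apply: (perp_kernel se); first by move=> Z rZ; apply/Ext1_right_projective_SFI/XS.
  apply: perp_zero => x; case: res' => e'inj _ _; apply: e'inj.
  by rewrite [LHS]X0 // [RHS]X0.
apply: IH; exists (fun n => X n.+1), (fun n => d n.+1), e'; split=> // n nm.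
  exact: XS.
exact: X0.
Qed.

End RightProjective.

(** * Projective dimension and syzygies of injective coresolutions *)

Section ProjectiveDimension.
Variable R : pzRingType.
Implicit Types A B C E I J K L M N P Q Z U : lmodType R.

Lemma Ext1_syzygy K P J N I N' (k : {linear K -> P}) (q : {linear P -> J})
    (i : {linear N -> I}) (p : {linear I -> N'}) :
  projective P -> short_exact k q -> injective_module I -> short_exact i p ->
  Ext1_vanishes J N' -> Ext1_vanishes K N.
Proof.
move=> Pp skq Ii [ker_ip ps] ext A B a b sab f.
have [g gE] := Ii _ _ a (comp_map i f) (proj1 (proj1 sab)).
have [x|phi phiE] := cokernel_factor (f := comp_map p g) sab.
  by rewrite comp_mapE gE comp_mapE (short_exact_comp0 _ ker_ip).
have [psi psiE] := ext _ _ _ _ skq phi.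
have [t tE] := Pp _ _ p psi ps.
have [x|h hE] := kernel_lift (f := sub_map g (comp_map t (comp_map k b))) ker_ip.
  by rewrite /= linearB tE psiE phiE subrr.
exists h => x; apply: (proj1 ker_ip).
by rewrite hE /= gE (short_exact_comp0 _ (proj1 sab)) (linear0 k) (linear0 t) subr0.
Qed.

Lemma Ext1_cosyzygy K P J N I N' (k : {linear K -> P}) (q : {linear P -> J})
    (i : {linear N -> I}) (p : {linear I -> N'}) :
  projective P -> short_exact k q -> injective_module I -> short_exact i p ->
  Ext1_vanishes K N -> Ext1_vanishes J N'.
Proof.
move=> Pp skq Ii sip ext; apply: (Ext1_of_presentation Pp skq) => f.
have [g gE] := Ext1_lift f sip ext.
have [h hE] := Ii _ _ k g (proj1 (proj1 skq)).
by exists (comp_map p h) => x; rewrite comp_mapE hE gE.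
Qed.

(** For these N, Ext^1(J, N) is some Ext^(n+1)(J, N0), and every Ext^(n+1)(J, N0) is of this form. *)
Fixpoint iterated_cosyzygy (n : nat) N : Prop :=
  match n with
  | 0 => True
  | k.+1 => exists N0 I (i : {linear N0 -> I}) (p : {linear I -> N}),
      [/\ iterated_cosyzygy k N0, injective_module I & short_exact i p]
  end.

(** Projective dimension at most n, defined by the vanishing of Ext^(n+1), so
    that the bound can be tested on any syzygy and not only on those of a
    resolution that witnesses it. *)
Definition pd_le (n : nat) J : Prop :=
  forall N, iterated_cosyzygy n N -> Ext1_vanishes J N.

Lemma pd_le_syzygy n K P J (k : {linear K -> P}) (q : {linear P -> J}) :
  projective P -> short_exact k q -> pd_le n.+1 J -> pd_le n K.
Proof.
move=> Pp skq pJ N Nn.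
have sN := cosyzygy_short_exact N; have Ii := @inj_module_injective R N.
apply: (Ext1_syzygy Pp skq Ii sN); apply: pJ.
by exists N, (inj_module N), (inj_emb N), (cosyzygy_proj N).
Qed.

Lemma pd_le_cover n K P J (k : {linear K -> P}) (q : {linear P -> J}) :
  projective P -> short_exact k q -> pd_le n K -> pd_le n.+1 J.
Proof.
move=> Pp skq pK N [N0 [I [i [p [N0n Ii sip]]]]].
exact: (Ext1_cosyzygy Pp skq Ii sip (pK _ N0n)).
Qed.

(** Lifting along a surjection is possible when Ext^1 into its kernel
    vanishes, and every module is a 0-th cosyzygy. *)
Lemma pd_le0_projective P : pd_le 0 P -> projective P.
Proof.
move=> pP A B g f gs; apply: Ext1_lift (kernel_short_exact gs) _; exact: pP.
Qed.

Lemma projective_pd_le n P : projective P -> pd_le n P.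
Proof.
move=> Pp N _ A B i p [ker_ip ps] f.
have [s sE] := Pp _ _ p (id_map P) ps.
have [x|r rE] := kernel_lift (f := sub_map (id_map B) (comp_map s p)) ker_ip.
  by rewrite /= linearB sE subrr.
exists (comp_map f r) => x; rewrite comp_mapE; congr (f _).
apply: (proj1 ker_ip).
by rewrite rE /= (short_exact_comp0 _ ker_ip) (linear0 s) subr0.
Qed.

Lemma iterated_cosyzygy_le m n N :
  (m <= n)%N -> iterated_cosyzygy n N -> iterated_cosyzygy m N.
Proof.
elim: m n N => [|m IH] [|n] N //= mn [N0 [I [i [p [N0n Ii sip]]]]].
by exists N0, I, i, p; split=> //; apply: IH N0n.
Qed.

Lemma pd_le_mono m n J : (m <= n)%N -> pd_le m J -> pd_le n J.
Proof. by move=> mn pJ N /(iterated_cosyzygy_le mn)/pJ. Qed.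

Lemma left_resolution_tail M (X : nat -> lmodType R)
    (d : forall n, {linear X n.+1 -> X n}) (e : {linear X 0%N -> M}) :
  left_resolution d e ->
  exists e' : {linear X 1%N -> sub_type (ker_sub e)},
    left_resolution (fun n => d n.+1) e'.
Proof.
move=> [es e0 ex].
have [|e' e'E] := kernel_lift (f := d 0%N) (ker_sub_kernel e).
  by move=> x; apply/e0; exists x.
exists e'; split=> [[y ey] | y | n]; last exact: ex.
  have /e0[x xy] := ey; exists x; apply: sub_val_inj.
  by rewrite -[LHS]/(sub_incl _ _) e'E.
apply: iff_trans (ex 0%N y); rewrite -e'E; split=> [->|]; first by rewrite linear0.
by move=> e0y; apply: sub_val_inj.
Qed.

Lemma left_resolution_pd_le n M : has_left_resolution (@projective R) M n -> pd_le n M.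
Proof.
elim: n M => [|n IH] M [X [d [e [res Xp X0]]]].
  apply: projective_pd_le => A B g f gs; have [es e0 _] := res.
  have [h hE] := Xp 0%N (leqnn 0) _ _ g (comp_map f e) gs.
  have [x /e0[y <-]|h' h'E] := factor_surj (f := h) es.
    by rewrite (X0 1%N isT y) (linear0 (d 0%N)) (linear0 h).
  by exists h' => x; have [x' <-] := es x; rewrite h'E hE.
have [es _ _] := res.
apply: (pd_le_cover (Xp 0%N isT) (kernel_short_exact es)); apply: IH.
have [e' res'] := left_resolution_tail res.
exists (fun n => X n.+1), (fun n => d n.+1), e'; split=> // k kn.
  exact: Xp.
exact: X0.
Qed.

Lemma projective_prod P Q : projective P -> projective Q -> projective (P * Q)%type.
Proof.
move=> Pp Qp A B g f gs.
have [h1 h1E] := Pp _ _ g (comp_map f (inl_map P Q)) gs.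
have [h2 h2E] := Qp _ _ g (comp_map f (inr_map P Q)) gs.
exists (add_map (comp_map h1 (fst_map P Q)) (comp_map h2 (snd_map P Q))) => -[x y].
rewrite -[X in g X]/(h1 x + h2 y) linearD h1E h2E !comp_mapE -linearD.
by rewrite -[X in f X]/(x + 0, 0 + y) addr0 add0r.
Qed.

(** The free covers of M and M' add up to a projective presentation of J,
    whose kernel J' is an extension of the two syzygies. As a syzygy of J, it has
    smaller projective dimension. *)
Lemma horseshoe M J M' (i : {linear M -> J}) (p : {linear J -> M'}) :
  short_exact i p ->
  exists J' (i' : {linear syzygy M -> J'}) (p' : {linear J' -> syzygy M'}),
    short_exact i' p' /\ forall n, pd_le n.+1 J -> pd_le n J'.
Proof.
move=> [ker_ip ps]; set F := free R M; set F' := free R M'.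
have Fp' : projective F' := free_projective R M'.
have [s sE] := Fp' _ _ p (free_cover M') ps.
pose e := free_cover M; pose e' := free_cover M'.
pose th : {linear (F * F')%type -> J} :=
  add_map (comp_map i (comp_map e (fst_map F F'))) (comp_map s (snd_map F F')).
have thE x y : th (x, y) = i (e x) + s y by [].
have ths : module_surjective th.
  move=> z; have [y ye] := free_cover_surj (p z).
  have /(proj2 ker_ip)[m mE] : p (z - s y) = 0 by rewrite linearB sE ye subrr.
  by have [x xE] := free_cover_surj m; exists (x, y); rewrite thE /e xE mE subrK.
pose J' := sub_type (ker_sub th).
have [ker_s es] := syzygy_short_exact M; have [ker_s' es'] := syzygy_short_exact M'.
have [|i' i'E] := kernel_lift (f := comp_map (inl_map F F') (syzygy_incl M))
  (ker_sub_kernel th).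
  by move=> x; rewrite thE /e (short_exact_comp0 _ ker_s) !linear0 addr0.
have [|p' p'E] :=
  kernel_lift (f := comp_map (snd_map F F') (sub_incl (ker_sub th))) ker_s'.
  move=> [[x y] xy]; rewrite -[X in free_cover M' X]/y -sE.
  have /(canRL (addKr _)) -> := etrans (esym (thE x y)) xy.
  by rewrite addr0 linearN (short_exact_comp0 _ ker_ip) oppr0.
have i'F x : sub_val (i' x) = (syzygy_incl M x, 0).
  by rewrite -[LHS]/(sub_incl _ (i' x)) i'E.
exists J', i', p'; split; last first.
  move=> n; apply: pd_le_syzygy (kernel_short_exact ths).
  exact/projective_prod/free_projective/free_projective.
split; last first.
  move=> y; have : p (s (syzygy_incl M' y)) = 0.
    by rewrite sE (short_exact_comp0 _ ker_s').
  move/(proj2 ker_ip) => [m mE]; have [x xE] := es m.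
  have xy : th (- x, syzygy_incl M' y) = 0.
    by rewrite thE linearN -/e xE linearN mE addNr.
  exists (@SubElt _ _ (ker_sub th) _ xy); apply: (proj1 ker_s').
  by rewrite p'E.
split=> [x y /(congr1 (@sub_val _ _ _)) | z].
  by rewrite !i'F => -[] /(proj1 ker_s).
split=> [|[x <-]]; last first.
  apply: (proj1 ker_s'); rewrite linear0 p'E comp_mapE.
  by rewrite -[X in snd_map _ _ X]/(sub_val (i' x)) i'F.
move=> pz; have y0 : (sub_val z).2 = 0 by have := p'E z; rewrite pz linear0.
have zE : sub_val z = ((sub_val z).1, 0) by rewrite -y0; case: (sub_val z).
have /(proj2 ker_s)[k kx] : e (sub_val z).1 = 0.
  apply: (proj1 ker_ip); have : th (sub_val z) = 0 := sub_valP z.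
  by rewrite zE thE (linear0 s) addr0 linear0.
by exists k; apply: sub_val_inj; rewrite i'F kx -zE.
Qed.

(** The sequence N is made of the cosyzygies of N 0 in a coresolution whose
    terms J k have projective dimension at most n. *)
Definition pd_le_chain (n : nat) (N : nat -> lmodType R) : Prop :=
  exists (J : nat -> lmodType R) (i : forall k, {linear N k -> J k})
         (p : forall k, {linear J k -> N k.+1}),
    forall k, short_exact (i k) (p k) /\ pd_le n (J k).

Lemma pd_le_chain_syzygy n (N : nat -> lmodType R) :
  pd_le_chain n.+1 N -> pd_le_chain n (fun k => syzygy (N k)).
Proof.
move=> [J [i [p H]]].
pose J1 k := cid (horseshoe (proj1 (H k))).
pose i1 k := cid (svalP (J1 k)); pose p1 k := cid (svalP (i1 k)).
exists (fun k => sval (J1 k)), (fun k => sval (i1 k)), (fun k => sval (p1 k)) => k.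
by have [sh pd'] := svalP (p1 k); split=> //; apply/pd'; case: (H k).
Qed.

Lemma pd_le_chain_iter n (N : nat -> lmodType R) :
  pd_le_chain n N -> pd_le_chain 0 (fun k => iter n (@syzygy R) (N k)).
Proof.
elim: n N => [|n IH] N //.
move=> /pd_le_chain_syzygy/IH; congr (pd_le_chain 0 _); apply/funext => k.
by rewrite -iterSr.
Qed.

Lemma chain_right_projective (N : nat -> lmodType R) :
  pd_le_chain 0 N -> right_projective (N 0%N).
Proof.
move=> [J [i [p H]]].
exists J, (fun k => comp_map (i k.+1) (p k)), (i 0%N).
split=> [k|]; first by apply: pd_le0_projective; case: (H k).
have kerE k : module_exact (i k) (comp_map (i k.+1) (p k)).
  by apply: exact_comp_inj; [case: (H k.+1) => -[[]] | case: (H k) => -[[]]].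
split=> [|//|k]; first by case: (H 0%N) => -[[]].
by apply: exact_comp_surj => //; case: (H k) => -[].
Qed.

Lemma syzygies_right_projective n M :
  (forall I, injective_module I -> pd_le n I) -> right_projective (iter n (@syzygy R) M).
Proof.
move=> Hn.
apply: (@chain_right_projective (fun k => iter n (@syzygy R) (cosyzygies k M))).
apply: pd_le_chain_iter.
exists (fun k => inj_module (cosyzygies k M)).
exists (fun k => inj_emb _), (fun k => cosyzygy_proj _) => k.
by split; [apply: cosyzygy_short_exact | apply/Hn/inj_module_injective].
Qed.

End ProjectiveDimension.

(** * Gorenstein projective modules and the main result *)

Section Complexes.
Variable R : pzRingType.
Implicit Types A B C E G I J K L M N P Q Z U : lmodType R.

Lemma hom_exact_Ext1 A B C Z P (f : {linear A -> B}) (g : {linear B -> C})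
    (p : {linear C -> Z}) :
  module_exact f g -> module_exact g p -> module_surjective p ->
  Ext1_vanishes Z P -> hom_exact f g P.
Proof.
move=> fg gp ps ext h; split=> [hf | [k kE] x]; last first.
  by rewrite -kE (_ : g (f x) = 0) ?linear0 //; apply/fg; exists x.
have [g' g's g'E] := image_factor g.
have [x g'x|h' h'E] := factor_surj (f := h) g's.
  by have /fg[y <-] : g x = 0; [rewrite -g'E g'x linear0 | apply: hf].
have sgp : short_exact (sub_incl (im_sub g)) p.
  split=> //; split; first exact: sub_val_inj.
  move=> y; apply: (iff_trans (gp y)); split=> [yg|[[z zg] <-] //].
  by exists (@SubElt _ _ (im_sub g) y yg).
have [k kE] := ext _ _ _ _ sgp h'.
by exists k => y; rewrite -g'E kE h'E.
Qed.

Lemma Ext1_Ext_succ Z N : Ext1_vanishes Z N -> Ext_succ_vanishes 0 Z N.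
Proof.
move=> ext X d e _ [es e0 ex]; exact: (hom_exact_Ext1 (ex 0%N) e0 es ext).
Qed.

Section Cast.
Variable X : int -> lmodType R.

(** Transport of a linear map along an equality of indices, needed because
    i - 1 + 1 and i are only propositionally equal integers. *)
Definition cast_dom (a b : int) (ab : a = b) C (f : {linear X b -> C}) :
    {linear X a -> C} :=
  match ab in _ = b return {linear X b -> C} -> {linear X a -> C} with
  | erefl => id
  end f.

Variable d : forall i : int, {linear X (i + 1) -> X i}.
Hypothesis X_projective : forall i, projective (X i).
Hypothesis d_exact : forall i, module_exact (d (i + 1)) (d i).

Lemma cast_dom_exact a b c (ab : a = b + 1) (bc : b = c + 1) :
  module_exact (cast_dom ab (d b)) (cast_dom bc (d c)).
Proof. by subst b; subst a; apply: d_exact. Qed.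

Lemma cast_dom_id (a : int) (e : a = a) C (f : {linear X a -> C}) : cast_dom e f = f.
Proof. by rewrite (Prop_irrelevance e erefl). Qed.

(** The part of an acyclic complex to the right of a cycle is a coresolution
    of that cycle. *)
Lemma cycle_right_projective N i (j : {linear N -> X (i + 1)}) :
  is_kernel j (d i) -> right_projective N.
Proof.
move=> [jinj jex]; pose ix k := iter k (fun a : int => a - 1) (i + 1).
have ixE k : ix k = ix k.+1 + 1 by rewrite /ix /= subrK.
exists (fun k => X (ix k)), (fun k => cast_dom (ixE k) (d (ix k.+1))), j.
split=> [k|]; first exact: X_projective.
split=> // [|k]; last exact: cast_dom_exact.
move=> y; apply: iff_trans (jex y).
suff e b (ib : i + 1 = b + 1) : cast_dom ib (d b) y = 0 <-> d i y = 0 by apply: e.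
have bi : i = b by apply: addIr ib.
by subst b; rewrite cast_dom_id.
Qed.

(** The cokernel of d i is again a cycle of the complex, hence right
    projective, and so Ext^1 from it to P vanishes. *)
Lemma acyclic_hom_exact P i : right_projective_perp P -> hom_exact (d (i + 1)) (d i) P.
Proof.
move=> pP.
suff H a b : b = a + 1 -> i = b + 1 -> hom_exact (d (i + 1)) (d i) P.
  by apply: (H (i - 1 - 1) (i - 1)); rewrite subrK.
move=> ba ib; subst b; subst i; set q := quo_proj (im_sub (d (a + 1 + 1))).
have qs : module_surjective q by apply: quo_proj_surj.
have qex : module_exact (d (a + 1 + 1)) q by apply: quo_proj_eq0.
apply: (hom_exact_Ext1 (@d_exact _) qex qs); apply: pP.
have [j [jinj jE]] := coimage_factor (@d_exact (a + 1)).
apply: (@cycle_right_projective _ a j); split=> // y.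
apply: (iff_trans (d_exact y)); split=> [[x <-] | [x <-]]; first by exists (q x).
by have [x' <-] := qs x; exists x'.
Qed.

End Cast.

Lemma Gorenstein_right_projective N : Gorenstein_projective N -> right_projective N.
Proof. by move=> [X [d [Xp dex _ [i [j /cycle_right_projective]]]]]; apply. Qed.

(** The successor of an integer, in a form that computes on constructors; it
    agrees with adding 1 only up to succzE. *)
Definition succz (i : int) : int :=
  match i with
  | Posz n => Posz n.+1
  | Negz 0 => Posz 0
  | Negz k.+1 => Negz k
  end.

Lemma succzE i : i + 1 = succz i.
Proof.
case: i => [n|[|n]] //=; first by rewrite -PoszD addn1.
by rewrite !NegzE -[in LHS]addn1 PoszD opprD addrK.
Qed.

(** Splicing a free resolution with a projective coresolution gives an
    acyclic complex of projectives; with all projectives in perp it is totally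
    acyclic. *)
Lemma right_projective_Gorenstein N :
  (forall P, projective P -> right_projective_perp P) ->
  right_projective N -> Gorenstein_projective N.
Proof.
move=> perpP [X [d [e [Xp [einj ex0 ex]]]]].
have [F [dF [eF [Fp [eFs eF0 Fex]]]]] := free_resolution N.
pose A (i : int) : lmodType R := match i with Posz n => F n | Negz n => X n end.
pose s (i : int) : {linear A (succz i) -> A i} :=
  match i as i0 return {linear A (succz i0) -> A i0} with
  | Posz n => dF n
  | Negz 0 => comp_map e eF
  | Negz k.+1 => d k
  end.
have Ap i : projective (A i) by case: i.
have sex i a b (ai : a = succz i) (ba : b = succz a) :
    module_exact (cast_dom ba (s a)) (cast_dom ai (s i)).
  subst b; subst a; case: i => [n|[|[|n]]] /=; [exact: (@Fex n) | | | exact: (@ex n)].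
    exact: exact_comp_inj.
  exact: exact_comp_surj.
exists A, (fun i => cast_dom (succzE i) (s i)).
have dex i : module_exact (cast_dom (succzE (i + 1)) (s (i + 1)))
    (cast_dom (succzE i) (s i)).
  exact: sex.
split=> // [P i Pp|]; first exact: (@acyclic_hom_exact A _ Ap dex P i (perpP _ Pp)).
(* The index -2: the module N is the kernel of the map X 0 -> X 1 of its
   coresolution, which sits in degrees -1 and -2. *)
exists (Negz 1), e; split=> // y; apply: iff_trans (ex0 y).
by rewrite (cast_dom_id (succzE (Negz 1))).
Qed.

Lemma has_left_resolution0 (C : lmodType R -> Prop) M : C M -> has_left_resolution C M 0.
Proof.
move=> CM; pose O := zero_mod R; have O0 := @zero_modE R.
exists (cons_mod M (fun=> O)),
  (@cons_down R M (fun=> O) (zero_map O M) (fun=> zero_map O O)), (id_map M).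
split=> [|[|n]//|[|n] // _ x]; last exact: O0.
split=> [y|y|[|n] y]; first by exists y.
- by split=> [y0|[x <-] //]; exists 0; apply: esym y0.
- by split=> _ //; exists 0; apply: O0.
- by split=> _; [exists 0; apply: O0 | apply: O0].
Qed.

Lemma has_left_resolution_cons (C : lmodType R -> Prop) K P M n
    (i : {linear K -> P}) (p : {linear P -> M}) :
  short_exact i p -> C P -> has_left_resolution C K n -> has_left_resolution C M n.+1.
Proof.
move=> sip CP [X [d [e [res CX X0]]]].
exists (cons_mod P X), (cons_down (comp_map i e) d), p.
split=> [|[|k] // kn|[|k] // kn];
  [exact: left_resolution_cons res | exact: CX | exact: X0].
Qed.

Lemma projective_right_projective P : projective P -> right_projective P.
Proof.
move=> Pp; pose O := zero_mod R; have O0 := @zero_modE R.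
have sPP : short_exact (id_map P) (zero_map P O).
  split=> [|y]; last by exists 0; apply: O0.
  by split=> [x y // | y]; split=> // _; exists y.
apply: (right_projective_cons Pp sPP).
exists (fun=> O), (fun=> zero_map O O), (id_map O); split=> [_|].
  exact: row_projective.
by split=> // [y|_ y]; split=> // _; [exists y | exists 0; apply: O0].
Qed.

Lemma syzygies_left_resolution (C : lmodType R -> Prop) n M :
  (forall P, projective P -> C P) -> C (iter n (@syzygy R) M) ->
  has_left_resolution C M n.
Proof.
move=> CP; elim: n M => [|n IH] M; first exact: has_left_resolution0.
rewrite iterSr => /IH; apply: has_left_resolution_cons (syzygy_short_exact M) _.
exact/CP/free_projective.
Qed.

(** The extension splits because Ext^1(Z, P) = 0; the retraction r is used
    to embed L in a projective module with the same cokernel as Z. *)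
Lemma right_projective_extension P L Z (i : {linear P -> L}) (p : {linear L -> Z}) :
  projective P -> short_exact i p -> Ext1_vanishes Z P -> right_projective Z ->
  right_projective L.
Proof.
move=> Pp sip ext /right_projective_cosyzygy[Q [Z' [j [q [Qp [[jinj jex] qs] rZ']]]]].
have [r rE] := ext _ _ _ _ sip (id_map P).
have [[iinj iex] ps] := sip.
have jlin : linear (fun l : L => (r l, j (p l)) : P * Q).
  by move=> a x y; rewrite !(linearP r, linearP p, linearP j).
pose j' := linear_map jlin.
apply: (right_projective_cons (i := j') (p := comp_map q (snd_map P Q)) _ _ rZ').
  exact: projective_prod.
have j'E l : j' l = (r l, j (p l)) by [].
split; last by move=> z; have [y <-] := qs z; exists (0, y).
split=> [x y | [x y]].
  rewrite !j'E => -[rxy /jinj pxy].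
  have /iex[z zE] : p (x - y) = 0 by rewrite linearB pxy subrr.
  have z0 : z = 0 by rewrite -[z]rE zE linearB rxy subrr.
  by apply/subr0_eq; rewrite -zE z0 linear0.
split=> [/jex[z zy] | [l <-]]; last by apply/jex; exists (p l).
have [l lz] := ps z; exists (l + i (x - r l)).
rewrite j'E (linearD r) rE (linearD p) (short_exact_comp0 _ (proj1 sip)) addr0 lz zy.
by rewrite addrC subrK.
Qed.

(** For n > 0, let K1 -> G1 -> syzygy M be the approximation of the first
    syzygy and b : G1 -> Q an embedding in a projective module with right
    projective cokernel G'. The pushout L of Q and the free cover F of M under
    G1 is an extension of G' by F, hence right projective. It still maps onto
    M, and the kernel of this map is Q / K1. *)
Lemma special_approximation n M :
  (forall P, projective P -> right_projective_perp P) ->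
  right_projective (iter n (@syzygy R) M) ->
  exists K G (i : {linear K -> G}) (p : {linear G -> M}),
    [/\ short_exact i p, right_projective G & right_projective_perp K].
Proof.
move=> perpP; elim: n M => [|n IH] M rM.
  pose O := zero_mod R; have O0 := @zero_modE R.
  exists O, M, (zero_map O M), (id_map M).
  split=> //; last by apply: perp_zero => x; apply: O0.
  split=> [|y]; last by exists y.
  split=> [x y _|y]; first exact: O0.
  by split=> [y0|[x <-] //]; exists 0; apply: esym y0.
move: rM; rewrite iterSr => /IH[K1 [G1 [k1 [p1 [[[k1inj k1ex] p1s] rG1 pK1]]]]].
have [Q [G' [b [c [Qp sbc rG']]]]] := right_projective_cosyzygy rG1.
have [[binj bex] cs] := sbc.
pose F := free R M; have [[sinj sex] es] := syzygy_short_exact M.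
have Fp : projective F := free_projective R M.
pose a := comp_map (syzygy_incl M) p1.
have abl : linear (fun g : G1 => (a g, - b g) : F * Q).
  by move=> t x y; rewrite !(linearP a, linearP b) opprD -scalerN.
pose ab := linear_map abl.
have abE g : ab g = (a g, - b g) by [].
(* The pushout of F and Q under G1. *)
pose L := quo_type (im_sub ab); pose q := quo_proj (im_sub ab).
have qs : module_surjective q by apply: quo_proj_surj.
have q0 z : q z = 0 <-> exists g, ab g = z by apply: quo_proj_eq0.
pose iF : {linear F -> L} := comp_map q (inl_map F Q).
have iFE x : iF x = q (x, 0) by [].
pose iQ : {linear Q -> L} := comp_map q (inr_map F Q).
have iQE x : iQ x = q (0, x) by [].
have [|lam lamE] := factor_surj (f := comp_map c (snd_map F Q)) qs.
  move=> z /q0[g <-]; rewrite -[LHS]/(c (- b g)) linearN.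
  by rewrite (short_exact_comp0 _ (proj1 sbc)) oppr0.
have [|ep epE] := factor_surj (f := comp_map (free_cover M) (fst_map F Q)) qs.
  move=> z /q0[g <-]; rewrite -[LHS]/(free_cover M (syzygy_incl M (p1 g))).
  exact: short_exact_comp0 (conj sinj sex).
have lamE' x y : lam (q (x, y)) = c y by rewrite lamE.
have epE' x y : ep (q (x, y)) = free_cover M x by rewrite epE.
have sL : short_exact iF lam.
  split; last by move=> z; have [y <-] := cs z; exists (q (0, y)).
  split=> [x y /eqP|z].
    rewrite -subr_eq0 -linearB => /eqP; rewrite iFE => /q0[g]; rewrite abE => -[ag bg].
    apply/subr0_eq; rewrite -ag (_ : g = 0) ?linear0 //.
    by apply: binj; rewrite linear0 -[LHS]opprK bg oppr0.
  have [[x y] <-] := qs z; rewrite lamE'; split=> [/bex[g gy]|[u uE]].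
    exists (x + a g); apply/subr0_eq; rewrite iFE -linearB; apply/q0; exists g.
    by rewrite abE -gy; congr (_, _); rewrite ?sub0r //= addrC addKr.
  by rewrite -(lamE' x y) -uE iFE lamE' linear0.
have rL : right_projective L.
  exact: (right_projective_extension Fp sL (perpP _ Fp _ rG') rG').
have eps : module_surjective ep.
  by move=> z; have [x <-] := es z; exists (q (x, 0)).
pose U := sub_type (ker_sub ep); pose u := sub_incl (ker_sub ep).
have [|v vE] := kernel_lift (f := iQ) (ker_sub_kernel ep).
  by move=> x; rewrite iQE epE' linear0.
have sU : short_exact (comp_map b k1) v.
  split.
    split=> [x y /binj/k1inj // | y].
    split=> [vy | [x <-]]; last first.
      apply: (@sub_val_inj _ _ (ker_sub ep)); rewrite -[LHS]/(sub_incl _ _) vE iQE.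
      apply/q0; exists (- k1 x).
      have ak : a (k1 x) = 0.
        by rewrite comp_mapE (short_exact_comp0 _ (conj k1inj k1ex)) linear0.
      by rewrite abE (linearN a) (linearN b) ak oppr0 opprK.
    have /q0[g] : q (0, y) = 0 by rewrite -iQE -vE vy linear0.
    rewrite abE => -[ag bg].
    have /k1ex[x xg] : p1 g = 0 by apply: sinj; rewrite linear0.
    by exists (- x); rewrite linearN comp_mapE xg.
  move=> [z ez]; have [[x y] xyz] := qs z.
  have /sex[s sx] : free_cover M x = 0 by rewrite -(epE' x y) xyz.
  have [g gs] := p1s s; exists (y + b g); apply: (@sub_val_inj _ _ (ker_sub ep)).
  rewrite -[LHS]/(sub_incl _ _) vE iQE -[RHS]/z -xyz; apply/subr0_eq; rewrite -linearB.
  apply/q0; exists (- g); rewrite abE (linearN a) (linearN b) opprK.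
  by rewrite comp_mapE gs sx -[RHS]/(0 - x, y + b g - y) sub0r addrAC subrr add0r.
exists U, L, u, ep; split=> //; first exact: kernel_short_exact.
exact: perp_cokernel sU pK1 (perpP _ Qp).
Qed.

End Complexes.

Lemma enat_least_finite (P : nat -> Prop) : enat_lt (enat_least P) None -> exists n, P n.
Proof.
rewrite /enat_least => -[_]; case: pselect => // -[n /asboolP Pn] _; by exists n.
Qed.

Lemma enat_least_le (P : nat -> Prop) n :
  enat_le (enat_least P) (Some n) <-> exists2 m, (m <= n)%N & P m.
Proof.
rewrite /enat_least; case: pselect => [ex|nex] /=.
  case: ex_minnP => m /asboolP Pm mmin; split=> [mn|[k kn Pk]]; first by exists m.
  by apply: leq_trans kn; apply/mmin/asboolP.
by split=> // -[m _ Pm]; apply: nex; exists m; apply/asboolP.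
Qed.

Theorem theorem3p6 (R : pzRingType)
    (proj_SFI_vee : forall P : lmodType R, projective P -> SFI_vee P)
    (pd_inj_finite : enat_lt (pd_injectives R) None) :
  enat_lt (gl_GPD R) None /\ special_precovering (@Gorenstein_projective R).
Proof.
have perpP (P : lmodType R) : projective P -> right_projective_perp P.
  by move=> /proj_SFI_vee/perp_SFI_vee.
have [n pdn] := enat_least_finite pd_inj_finite.
have rM (M : lmodType R) : right_projective (iter n (@syzygy R) M).
  apply: syzygies_right_projective => I /pdn/enat_least_le[m mn].
  by move/left_resolution_pd_le; apply: pd_le_mono.
split.
  have fin : enat_le (gl_GPD R) (Some n).
    apply/enat_least_le; exists n => // M _; apply/enat_least_le; exists n => //.
    apply: syzygies_left_resolution; last exact: right_projective_Gorenstein.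
    by move=> P Pp; apply/right_projective_Gorenstein/projective_right_projective.
  by split; [case: (gl_GPD R) | move=> e; rewrite e in fin].
move=> M; have [K [G [i [p [[ker_ip ps] rG pK]]]]] := special_approximation perpP (rM M).
exists G, p; split=> //; first exact: right_projective_Gorenstein.
exists K, i; split=> // X' /Gorenstein_right_projective/pK; exact: Ext1_Ext_succ.
Qed.
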